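(* Let $\ell:[0,1]\to\mathbb R$ be an affine function; in particular, $\ell\in\mathcal H^1_\infty(0,1)$. Let $k\ge1$, $s\in(\frac12,2]$ and $\widetilde\mu\in\mathcal H^s_2(0,1)$. Set $\mu:=\ell+\widetilde\mu$. Then $$K_{\mu,k}(\omega)=\frac{\pi\sqrt2\,\langle\mu^2,\varphi_k'\rangle}{k\,\omega^2}-\frac{\pi^2\sqrt2\left(\mu(0)^2+(-1)^k\mu(1)^2\right)}{\omega^{\frac52}}+\mathcal O\left(\frac1{\omega^{\frac52+\nu}}\right)\quad\text{when }\omega\to+\infty,$$ where $\nu:=\frac s2-\frac14>0$. If $\mu\equiv1$ and $k$ is even, then $$K_{\mu,k}(\omega)=-\frac{2\pi^2\sqrt2}{\omega^{\frac52}}+\mathcal O\left(\frac1{\omega^{\frac72}}\right)\quad\text{when }\omega\to+\infty.$$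
   Context: All functions are real-valued. For $j\ge1$, $\lambda_j=(j\pi)^2$, $\varphi_j(x)=\sqrt2\sin(j\pi x)$; $\langle f,g\rangle=\int_0^1fg$. For $s\in\mathbb R$, $p\in[1,\infty]$, $\mathcal H^s_p(0,1)$ is the space of (generalized) sine series $\mu=\sum_j\langle\mu,\varphi_j\rangle\varphi_j$ with $\|\mu\|_{\mathcal H^s_p}:=\|(\lambda_j^{s/2}\langle\mu,\varphi_j\rangle)_{j\ge1}\|_{\ell^p}<\infty$. (For $s>\frac12$, elements of $\mathcal H^s_2$ are continuous on $[0,1]$ and vanish at $0$ and $1$, so $\mu(0),\mu(1)$ make sense.) With $\lambda_{n,k}:=\lambda_n-\frac{\lambda_k}2$, for $\omega\in\mathbb R$, $$K_{\mu,k}(\omega)=\sum_{n\ge1}\frac{\langle\mu,\varphi_n\rangle}{n}\left(\frac{\langle\mu,\varphi_{n+k}\rangle}{n+k}+\frac{\langle\mu,\varphi_{|n-k|}\rangle}{|n-k|}\mathbb 1_{n\ne k}\right)\frac{\lambda_{n,k}}{\lambda_{n,k}^2+\omega^2}.$$ *)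

(* Defs.v *)
From HB Require Import structures.
From mathcomp Require Import all_boot all_order all_algebra.
From mathcomp Require Import all_classical all_reals all_analysis.

Set Implicit Arguments.
Unset Strict Implicit.
Unset Printing Implicit Defensive.

Import Order.TTheory GRing.Theory Num.Theory.
Import numFieldTopology.Exports numFieldNormedType.Exports.

Local Open Scope classical_set_scope.
Local Open Scope ring_scope.

(* Lets the Landau notations find the filter structure of [+oo]. *)
Canonical pinfty_filter_on (R : realType) :=
  FilterType (pinfty_nbhs R) _.

Definition lambda (R : realType) (j : nat) : R := (j%:R * pi) ^+ 2.

Definition phi (R : realType) (j : nat) (x : R) : R :=
  Num.sqrt 2 * sin (j%:R * pi * x).

Definition inner (R : realType) (f g : R -> R) : R :=
  \int[lebesgue_measure]_(x in `[0, 1]) (f x * g x).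

Definition sine_coef (R : realType) (f : R -> R) (j : nat) : R :=
  inner f (phi j).

(* A generalized sine series is identified with the sequence [c] of its
   coefficients, [c j] being the coefficient of [phi j] for [1 <= j]; the value
   [c 0] is never used. [Hnorm] is a norm for [1 <= p <= +oo]. *)
Definition Hnorm (R : realType) (s : R) (p : \bar R) (c : nat -> R) : \bar R :=
  Lnorm counting p
    (fun i : nat => (lambda R i.+1 `^ (s / 2) * c i.+1)%:E).

Definition Hspace (R : realType) (s : R) (p : \bar R) : set (nat -> R) :=
  [set c | (Hnorm s p c < +oo)%E].

(* The sum of the sine series with coefficients [c]. It is meaningful only if
   the series converges at [x], which is the case everywhere (absolutely and
   uniformly) for [c] in [Hspace s 2] with [1 / 2 < s]; the sum is then the
   continuous representative, with values 0 at 0 and 1. *)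
Definition sine_sum (R : realType) (c : nat -> R) (x : R) : R :=
  limn (series (fun i => c i.+1 * phi i.+1 x)).

Definition affine01 (R : realType) (f : R -> R) : Prop :=
  exists a b : R, forall x, x \in `[0, 1] -> f x = a * x + b.

Definition lambda2 (R : realType) (n k : nat) : R :=
  lambda R n - lambda R k / 2.

Definition Kterm (R : realType) (mu : R -> R) (k : nat) (w : R) (n : nat) : R :=
  sine_coef mu n / n%:R *
  (sine_coef mu (n + k) / (n + k)%:R +
   sine_coef mu `|n%:Z - k%:Z|%N / `|n%:Z - k%:Z|%N%:R * (n != k)%:R) *
  (lambda2 R n k / (lambda2 R n k ^+ 2 + w ^+ 2)).

(* The sum over [1 <= n]; the series converges absolutely as soon as the
   coefficients are bounded. *)
Definition K (R : realType) (mu : R -> R) (k : nat) (w : R) : R :=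
  limn (series (fun i => Kterm mu k w i.+1)).

(* Main.v *)
Require Import Defs.
From HB Require Import structures.
From mathcomp Require Import all_boot all_order all_algebra.
From mathcomp Require Import all_classical all_reals all_analysis ess_sup_inf.
From mathcomp Require Import ring lra zify.

Set Implicit Arguments.
Unset Strict Implicit.
Unset Printing Implicit Defensive.

Import Order.TTheory GRing.Theory Num.Theory.
Import numFieldTopology.Exports numFieldNormedType.Exports.

Local Open Scope classical_set_scope.
Local Open Scope ring_scope.

(** Write mu_n for the sine coefficients of mu, p_n = mu_n / n,
    a_n = p_n (p_(n+k) + p_|n-k|), with p_0 = 0, and x_n = lambda_n - lambda_k / 2.
    Since x / (x^2 + w^2) = (x - F x) / w^2 with F x = x^3 / (x^2 + w^2),
    w^2 K(w) is the constant Sum a_n x_n minus Sum a_n F(x_n).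

    The constant. Shifting n by k in the terms with p_|n-k| pairs x_n with x_(n+k),
    and x_n + x_(n+k) = 2 pi^2 n (n+k) cancels the denominators: the sum is
    2 pi^2 (Sum mu_n mu_(n+k) - 1/2 Sum_(0<n<k) mu_n mu_(k-n)) (lambda_corr_cvg).
    The bracket is the integral of mu^2 cos(k pi x) (int01_sqr_cos), because
    multiplying phi_n by that cosine gives (phi_(n+k) + phi_(n-k)) / 2. The sine sum
    converges uniformly, so it may be integrated term by term against the other
    factors; for the square of the affine function both sides are explicit, the
    series being telescopic.

    The second sum. With al = mu(0), be = mu(1), the affine part has coefficients
    sqrt 2 (al - (-1)^n be) / (n pi). Hence a_n is the sum of
    (4 / pi^2) (A - (-1)^n B) / n^4, with A = al^2 + (-1)^k be^2 and
    B = al be (1 + (-1)^k), of a remainder of size n^-6, and of terms that contain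
    some c_n. Let h = w^(-1/2).
    - The n^-6 remainder contributes O(h^3), and so does the replacement of F(x_n) by
      F(lambda_n) in the leading part (affine_error_sum). What is left is a
      Riemann sum of step pi h for y^2 / (1 + y^4), whose integral over the positive
      half-line is pi / (2 sqrt 2). The trapezoidal rule is of second order and the
      function vanishes at 0, so the sum is sqrt 2 pi^2 A h + O(h^3)
      (affine_main_sum). The sum with signs (-1)^n is twice the sum of step 2 pi h
      minus the one of step pi h, hence has no main term (sum_alt_quartic).
    - The terms with c_n are controlled by the square-summable n^s c_n: a weighted
      inequality of the means, applied termwise, gives O(h^(s + 1/2))
      (corr_rest_sum).

    Dividing by w^2 = h^-4 turns these errors into h^7 = w^(-7/2) and
    h^(s + 9/2) = w^-(5/2 + nu); the first is the smaller one as s <= 2. When mu = 1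
    all the c_n vanish and only the first remains.

    Sums over n >= 1 are written as sums over i of the term of index i.+1. *)

(** * Series and their partial sums *)

Section Series.
Context {R : realType}.
Implicit Types (u v : R^nat).

(** The form in which series are summed throughout: a bound on the partial sums
    of a majorant gives both the convergence and a bound on the sum, so that the
    sum of the majorant never has to be named. *)
Lemma dominated_series u v (M : R) :
  (forall i, `|u i| <= v i) -> (forall N, series v N <= M) ->
  exists2 l, series u @ \oo --> l & `|l| <= M.
Proof.
move=> uv vM.
have v0 i : 0 <= v i by apply: le_trans (uv i).
have cv : cvgn (series v).
  apply: nondecreasing_is_cvgn.
    by apply: nondecreasing_series => i _ _; exact: v0.
  by exists M => _ [N _ <-]; exact: vM.
have cu : cvgn (series u).
  by apply: normed_cvg; exact: (series_le_cvg (fun i => normr_ge0 (u i)) v0 uv cv).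
have uM N : `|series u N| <= M.
  apply: le_trans (vM N); rewrite /series /=.
  by apply: le_trans (ler_norm_sum _ _ _) _; apply: ler_sum.
exists (limn (series u)); first exact: cu.
rewrite ler_norml; apply/andP; split.
  apply: limr_ge => //; apply: nearW => N.
  by have := uM N; rewrite ler_norml => /andP[].
apply: limr_le => //; apply: nearW => N.
by have := uM N; rewrite ler_norml => /andP[].
Qed.

Lemma cvg_seriesD u v (a b : R) :
  series u @ \oo --> a -> series v @ \oo --> b ->
  series (fun i => u i + v i) @ \oo --> a + b.
Proof.
move=> ua vb.
have -> : series (fun i => u i + v i) = series u \+ series v.
  by apply/funext => N; rewrite /series /= big_split.
exact: cvgD.
Qed.

Lemma cvg_seriesZ (k : R) u (a : R) :
  series u @ \oo --> a -> series (fun i => k * u i) @ \oo --> k * a.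
Proof.
move=> ua.
have -> : series (fun i => k * u i) = (fun N => k * series u N).
  by apply/funext => N; rewrite /series /= mulr_sumr.
exact: cvgMl_tmp.
Qed.

Lemma cvg_seriesB u v (a b : R) :
  series u @ \oo --> a -> series v @ \oo --> b ->
  series (fun i => u i - v i) @ \oo --> a - b.
Proof.
move=> ua vb.
have -> : series (fun i => u i - v i) = series u \- series v.
  by apply/funext => N; rewrite /series /= sumrB.
exact: cvgB.
Qed.

Lemma eq_cvg_series u v (a : R) : u =1 v ->
  series v @ \oo --> a -> series u @ \oo --> a.
Proof. by move=> /funext ->. Qed.

Lemma cvg_series_shift (k : nat) u (a : R) :
  series (fun i => u (i + k)%N) @ \oo --> a ->
  series u @ \oo --> \sum_(0 <= i < k) u i + a.
Proof.
move=> h; rewrite -(cvg_shiftn k) /=.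
have -> : (fun n => series u (n + k)%N) =
    (fun N => \sum_(0 <= i < k) u i + series (fun i => u (i + k)%N) N).
  apply/funext => N; rewrite /series /= addnC.
  rewrite (@big_cat_nat _ _ _ k) //=; last by rewrite leq_addr.
  by rewrite -{2}[k]add0n big_addn addKn.
by apply: cvgD => //; exact: cvg_cst.
Qed.

Lemma ge0_sum_le_series u (M : R) : (forall i, 0 <= u i) ->
  series u @ \oo --> M -> forall N, series u N <= M.
Proof.
move=> u0 uM N; rewrite -(cvg_lim _ uM) //.
apply: nondecreasing_cvgn_le; last by apply/cvg_ex; exists M.
by apply: nondecreasing_series => i _ _; exact: u0.
Qed.

(** Telescoping: each term is at most the decrement of t |-> 1 / (1 + t h) over
    one step. This is the comparison series of all the estimates that follow, with
    a bound that does not depend on the step. *)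
Lemma sum_inv_sqr_step_le (h : R) (N : nat) : 0 <= h ->
  \sum_(0 <= i < N) (h / (1 + i.+1%:R * h) ^+ 2) <= 1.
Proof.
move=> h0; suff : \sum_(0 <= i < N) (h / (1 + i.+1%:R * h) ^+ 2) <=
   1 - (1 + N%:R * h)^-1.
  move/le_trans; apply; rewrite gerBl invr_ge0.
  by apply: addr_ge0 => //; apply: mulr_ge0.
have pos n : 0 < 1 + n%:R * h by apply: ltr_wpDr => //; apply: mulr_ge0.
elim: N => [|N IH]; first by rewrite big_geq // mul0r addr0 invr1 subrr.
rewrite big_nat_recr //=.
apply: le_trans (lerD IH (lexx _)) _.
rewrite -addrA lerD2l.
have pN := pos N; have pS := pos N.+1.
have -> : - (1 + N%:R * h)^-1 + h / (1 + N.+1%:R * h) ^+ 2 =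
  - (1 + N.+1%:R * h)^-1 - h ^+ 2 / ((1 + N%:R * h) * (1 + N.+1%:R * h) ^+ 2).
  rewrite -natr1 in pS *.
  by field; rewrite !gt_eqF.
by rewrite gerBl divr_ge0 // ?sqr_ge0 // mulr_ge0 // ?sqr_ge0 // ltW.
Qed.

(** A discrete form of the integral test for n^-(1+a), obtained from
    (1 - x)^-a >= 1 + a x at x = 1 / (n+1). *)
Lemma powR_telescope (a : R) (n : nat) : 0 < a -> (0 < n)%N ->
  a / (1 + a) / (n.+1%:R `^ (1 + a)) <= n%:R `^ (- a) - n.+1%:R `^ (- a).
Proof.
move=> a0 n0.
have n0' : (0 : R) < n%:R by rewrite ltr0n.
have n1 : (0 : R) < n.+1%:R by rewrite ltr0n.
set x : R := n.+1%:R^-1.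
have x0 : 0 < x by rewrite invr_gt0.
have x1 : x < 1 by rewrite invf_lt1 // ltr1n.
have nE : (n%:R : R) = n.+1%:R * (1 - x).
  by rewrite mulrBr mulr1 mulfV ?gt_eqF // -natr1 addrK.
have key : 1 + a * x <= (1 - x) `^ (- a).
  rewrite /powR gt_eqF ?subr_gt0 //.
  apply: le_trans (expR_ge1Dx _).
  rewrite lerD2l mulNr -mulrN ler_pM2l // lerNr.
  by apply: le_ln1Dx; rewrite ltrN2.
have -> : n%:R `^ (- a) - n.+1%:R `^ (- a) =
   n.+1%:R `^ (- a) * ((1 - x) `^ (- a) - 1).
  by rewrite nE powRM ?(ltW n1) ?subr_ge0 ?(ltW x1)//; ring.
have -> : a / (1 + a) / n.+1%:R `^ (1 + a) = n.+1%:R `^ (- a) * (a / (1 + a) * x).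
  have -> : n.+1%:R `^ (1 + a) = n.+1%:R * n.+1%:R `^ a.
    by rewrite powRD ?(gt_eqF n1) ?implybT // powRr1 // ltW.
  rewrite powRN /x invfM.
  by ring.
rewrite ler_pM2l ?powR_gt0 //.
apply: le_trans (_ : a * x <= _); last by rewrite lerBrDl.
rewrite ler_pM2r // ler_pdivrMr ?addr_gt0 // ler_peMr ?ltW ?ltrDl //.

Qed.

Lemma sum_powR_le (a : R) : 0 < a -> exists M : R, forall N,
  \sum_(0 <= i < N) (i.+1%:R `^ (1 + a))^-1 <= M.
Proof.
move=> a0; exists (1 + (1 + a) / a) => N.
have apos : 0 < 1 + a by rewrite addr_gt0.
suff : \sum_(0 <= i < N.+1) (i.+1%:R `^ (1 + a))^-1
    <= 1 + (1 + a) / a * (1 - N.+1%:R `^ (- a)).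
  move=> h; apply: le_trans (_ : \sum_(0 <= i < N.+1) (i.+1%:R `^ (1 + a))^-1 <= _).
    by rewrite big_nat_recr //= lerDl invr_ge0 powR_ge0.
  apply: le_trans h _; rewrite lerD2l ler_piMr ?gerBl ?powR_ge0 //.
  by rewrite divr_ge0 // ltW.
elim: N => [|N IH].
  by rewrite big_nat1 !powR1 subrr mulr0 addr0 invr1.
rewrite big_nat_recr //=.
apply: le_trans (lerD IH (lexx _)) _.
rewrite -addrA lerD2l -lerBrDl -mulrBr.
have := @powR_telescope a N.+1 a0 isT.
rewrite mulrC -ler_pdivlMr ?divr_gt0 // invf_div mulrC => /le_trans; apply.
by rewrite ler_pM2l ?divr_gt0 //; lra.
Qed.

End Series.

(** * Derivatives and the trapezoidal rule on the half-line *)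

Section Derivatives.
Context {R : realType}.
Implicit Types (f g : R -> R) (x a b : R).

Lemma is_derive_fD f g x a b : is_derive x 1 f a -> is_derive x 1 g b ->
  is_derive x 1 (fun y => f y + g y) (a + b).
Proof. exact: is_deriveD. Qed.

Lemma is_derive_fB f g x a b : is_derive x 1 f a -> is_derive x 1 g b ->
  is_derive x 1 (fun y => f y - g y) (a - b).
Proof. exact: is_deriveB. Qed.

Lemma is_derive_fM f g x a b : is_derive x 1 f a -> is_derive x 1 g b ->
  is_derive x 1 (fun y => f y * g y) (a * g x + f x * b).
Proof.
move=> fa gb; apply: (@is_derive_eq _ _ _ _ _ _ _ _ (is_deriveM fa gb)).
by rewrite /GRing.scale /=; ring.
Qed.

Lemma is_derive_fX f n x a : is_derive x 1 f a ->
  is_derive x 1 (fun y => f y ^+ n) (n%:R * f x ^+ n.-1 * a).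
Proof.
move=> fa; have -> : (fun y => f y ^+ n) = f ^+ n by rewrite exprfctE.
exact: is_deriveX.
Qed.

Lemma is_derive_fV g x b : g x != 0 -> is_derive x 1 g b ->
  is_derive x 1 (fun y => (g y)^-1) (- b / g x ^+ 2).
Proof.
move=> g0 gb.
have dg : derivable g x 1 by [].
apply: DeriveDef; first exact: derivableV.
by rewrite deriveV // (derive_val (is_derive := gb)) /GRing.scale /= !mulNr mulrC.
Qed.

Lemma is_derive_comp f g x a b : is_derive (g x) 1 f a -> is_derive x 1 g b ->
  is_derive x 1 (fun y => f (g y)) (a * b).
Proof. exact: is_derive1_comp. Qed.

Lemma derive_bound f (df : R -> R) (a b M : R) : a <= b ->
  (forall x, a <= x <= b -> is_derive x 1 f (df x)) ->
  (forall x, a <= x <= b -> `|df x| <= M) ->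
  `|f b - f a| <= M * (b - a).
Proof.
move=> ab fdf dfM.
have [||c cab ->] := MVT_segment (f := f) (df := df) ab.
- by move=> x xab; apply: fdf; rewrite !ltW ?(itvP xab).
- apply: derivable_within_continuous => x xab.
  have := fdf x; rewrite !(itvP xab) => /(_ isT) [] //.
- rewrite normrM (ger0_norm (x := b - a)) ?subr_ge0 //.
  by apply: ler_wpM2r; rewrite ?subr_ge0 // dfM // !(itvP cab).
Qed.

(** Taylor expansion with the increment of the step as variable: the error and
    its derivative both vanish at z = y, and the second derivative is
    - (z - y) g'' z / 2. *)
Lemma trapezoid_step (G g g1 g2 : R -> R) (y H m : R) : 0 <= H ->
  (forall z, y <= z <= y + H -> is_derive z 1 G (g z)) ->
  (forall z, y <= z <= y + H -> is_derive z 1 g (g1 z)) ->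
  (forall z, y <= z <= y + H -> is_derive z 1 g1 (g2 z)) ->
  (forall z, y <= z <= y + H -> `|g2 z| <= m) ->
  `|G (y + H) - G y - H / 2 * (g y + g (y + H))| <= m / 2 * H ^+ 3.
Proof.
move=> H0 dG dg dg1 g2m.
have m0 : 0 <= m by apply: le_trans (normr_ge0 _) (g2m y _); rewrite lexx lerDl.
pose D1 z := g z - g y - (z - y) * g1 z.
have D1_le z : y <= z <= y + H -> `|D1 z| <= m * H ^+ 2.
  move=> /andP[yz zH].
  have -> : D1 z = D1 z - D1 y by rewrite /D1 !subrr mul0r !subrr subr0.
  have := @derive_bound D1 (fun t => - ((t - y) * g2 t)) y z (m * H) yz.
  move=> h; apply: le_trans (h _ _) _.
  - move=> t /andP[yt tz]; have ytH : y <= t <= y + H by rewrite yt (le_trans tz).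
    have dd1 := is_derive_fB (is_derive_id t 1) (is_derive_cst y t 1).
    have dd2 := is_derive_fM dd1 (dg1 _ ytH).
    have dd3 := is_derive_fB (is_derive_fB (dg _ ytH) (is_derive_cst (g y) t 1)) dd2.
    by apply: is_derive_eq dd3 _; rewrite /=; ring.
  - move=> t /andP[yt tz]; have ytH : y <= t <= y + H by rewrite yt (le_trans tz).
    rewrite normrN normrM mulrC (ger0_norm (x := t - y)) ?subr_ge0 //.
    by apply: ler_pM; rewrite ?subr_ge0 ?g2m //; lra.
  - rewrite expr2 mulrA; apply: ler_wpM2l; [exact: mulr_ge0|lra].
pose D z := G z - G y - (z - y) / 2 * (g y + g z).
have -> : G (y + H) - G y - H / 2 * (g y + g (y + H)) = D (y + H) - D y.
  by rewrite /D; field.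
have yH : y <= y + H by rewrite lerDl.
have := @derive_bound D (fun t => D1 t / 2) y (y + H) (m * H ^+ 2 / 2) yH.
move=> h; apply: le_trans (h _ _) _.
- move=> t yt.
  have dd1 := is_derive_fB (is_derive_id t 1) (is_derive_cst y t 1).
  have dd1' := is_derive_fM dd1 (is_derive_cst (2^-1 : R) t 1).
  have dd2 := is_derive_fM dd1' (is_derive_fD (is_derive_cst (g y) t 1) (dg _ yt)).
  have dd3 := is_derive_fB (is_derive_fB (dG _ yt) (is_derive_cst (G y) t 1)) dd2.
  by apply: is_derive_eq dd3 _; rewrite /D1 /=; field.
- move=> t yt; rewrite normrM (ger0_norm (x := 2^-1)) //.
  by rewrite ler_pM2r //; exact: D1_le.
- by rewrite le_eqVlt; apply/orP; left; apply/eqP; ring.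
Qed.

(** The decay of g'' makes the local errors summable, with a total of order
    H ^+ 2 that is uniform in N. *)
Lemma trapezoid_sum (G g g1 g2 : R -> R) (H m : R) (N : nat) : 0 <= H -> 0 <= m ->
  (forall z : R, 0 <= z -> is_derive z 1 G (g z)) ->
  (forall z : R, 0 <= z -> is_derive z 1 g (g1 z)) ->
  (forall z : R, 0 <= z -> is_derive z 1 g1 (g2 z)) ->
  (forall z : R, 0 <= z -> `|g2 z| <= m / (1 + z) ^+ 2) ->
  `|G (N%:R * H) - G 0 - H * \sum_(0 <= i < N) g (i.+1%:R * H)
    + H / 2 * (g (N%:R * H) - g 0)| <= m / 2 * H ^+ 2 * (H + 1).
Proof.
move=> H0 m0 dG dg dg1 g2m.
suff : `|G (N%:R * H) - G 0 - H * \sum_(0 <= i < N) g (i.+1%:R * H)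
    + H / 2 * (g (N%:R * H) - g 0)| <=
   m / 2 * H ^+ 2 * \sum_(0 <= i < N) (H / (1 + i%:R * H) ^+ 2).
  move/le_trans; apply; apply: ler_wpM2l.
    by rewrite mulr_ge0 // ?divr_ge0 // sqr_ge0.
  case: N => [|N]; first by rewrite big_geq // addr_ge0.
  rewrite big_nat_recl //= mul0r addr0 expr1n divr1.
  by rewrite lerD2l sum_inv_sqr_step_le.
elim: N => [|N IH].
  by rewrite !big_geq // mul0r !subrr !mulr0 subr0 addr0 normr0.
rewrite !(big_nat_recr N) //= mulrDr.
set S := \sum_(0 <= i < N) g _ in IH *.
have NH0 : 0 <= N%:R * H by exact: mulr_ge0.
have E : N.+1%:R * H = N%:R * H + H by rewrite -natr1; ring.
have := @trapezoid_step G g g1 g2 (N%:R * H) H (m / (1 + N%:R * H) ^+ 2) H0.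
rewrite -E => step.
have -> : G (N.+1%:R * H) - G 0 - (H * S + H * g (N.+1%:R * H)) +
   H / 2 * (g (N.+1%:R * H) - g 0) =
   (G (N%:R * H) - G 0 - H * S + H / 2 * (g (N%:R * H) - g 0)) +
   (G (N.+1%:R * H) - G (N%:R * H) - H / 2 * (g (N%:R * H) + g (N.+1%:R * H))).
  by field.
apply: le_trans (ler_normD _ _) _; rewrite [leRHS]mulrDr.
apply: lerD => //.
apply: le_trans (step _ _ _ _) _.
- by move=> z /andP[h _]; apply: dG; exact: le_trans h.
- by move=> z /andP[h _]; apply: dg; exact: le_trans h.
- by move=> z /andP[h _]; apply: dg1; exact: le_trans h.
- move=> z /andP[h _]; apply: le_trans (g2m _ (le_trans NH0 h)) _.
  rewrite ler_wpM2l // lef_pV2 ?posrE ?exprn_gt0 //; try lra.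
  by rewrite ler_sqr ?nnegrE; lra.
- by rewrite le_eqVlt; apply/orP; left; apply/eqP; ring.
Qed.

End Derivatives.

(** * Riemann sums of y^2 / (1 + y^4) *)

Section Quartic.
Context {R : realType}.
Implicit Types (x y H : R).

Definition quartic (y : R) : R := y ^+ 2 / (1 + y ^+ 4).
Definition quartic1 (y : R) : R := (2 * y - 2 * y ^+ 5) / (1 + y ^+ 4) ^+ 2.
Definition quartic2 (y : R) : R :=
  (2 - 24 * y ^+ 4 + 6 * y ^+ 8) / (1 + y ^+ 4) ^+ 3.

Let r2 : R := Num.sqrt 2.

(** The primitive of [quartic] that vanishes at 0, from the factorization
    1 + y^4 = (y^2 + r2 y + 1) (y^2 - r2 y + 1). *)
Definition quartic_int (y : R) : R :=
  (2 * r2)^-1 * (atan (r2 * y + 1) + atan (r2 * y - 1)) +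
  (4 * r2)^-1 * (ln (y ^+ 2 - r2 * y + 1) - ln (y ^+ 2 + r2 * y + 1)).

Lemma sqr_r2 : r2 ^+ 2 = 2. Proof. by rewrite sqr_sqrtr. Qed.
Lemma r2_gt0 : 0 < r2. Proof. by rewrite sqrtr_gt0. Qed.

Lemma quartic_den_gt0 y : 0 < 1 + y ^+ 4.
Proof. by rewrite ltr_wpDr // exprn_even_ge0. Qed.

Lemma den_minus_gt0 y : 0 < y ^+ 2 - r2 * y + 1.
Proof.
have -> : y ^+ 2 - r2 * y + 1 = (y - r2 / 2) ^+ 2 + (1 - r2 ^+ 2 / 4) by field.
by rewrite sqr_r2 ltr_wpDl // ?sqr_ge0 //; lra.
Qed.

Lemma den_plus_gt0 y : 0 < y ^+ 2 + r2 * y + 1.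
Proof. by have := den_minus_gt0 (- y); rewrite sqrrN mulrN opprK. Qed.

Lemma is_derive_quartic y : is_derive y 1 quartic (quartic1 y).
Proof.
have d0 : 1 + y ^+ 4 != 0 by rewrite gt_eqF // quartic_den_gt0.
have n2 := is_derive_fX 2 (is_derive_id y 1).
have n4 := is_derive_fD (is_derive_cst (1 : R) y 1) (is_derive_fX 4 (is_derive_id y 1)).
have := is_derive_fM n2 (is_derive_fV (g := fun y => 1 + y ^+ 4) d0 n4).
move=> h; apply: is_derive_eq h _; rewrite /quartic1 /=.
by field.
Qed.

Lemma is_derive_quartic1 y : is_derive y 1 quartic1 (quartic2 y).
Proof.
have d0 : 1 + y ^+ 4 != 0 by rewrite gt_eqF // quartic_den_gt0.
have d2 : (1 + y ^+ 4) ^+ 2 != 0 by rewrite expf_neq0.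
have id1 := is_derive_id y (1 : R).
have n1 := is_derive_fM (is_derive_cst (2 : R) y 1) id1.
have n5 := is_derive_fM (is_derive_cst (2 : R) y 1) (is_derive_fX 5 id1).
have n4 := is_derive_fD (is_derive_cst (1 : R) y 1) (is_derive_fX 4 id1).
have := is_derive_fM (is_derive_fB n1 n5)
  (is_derive_fV (g := fun y => (1 + y ^+ 4) ^+ 2) d2 (is_derive_fX 2 n4)).
move=> h; apply: is_derive_eq h _; rewrite /quartic2 /=.
by field.
Qed.

Lemma is_derive_quartic_int y : is_derive y 1 quartic_int (quartic y).
Proof.
have dm := den_minus_gt0 y; have dp := den_plus_gt0 y.
have id1 := is_derive_id y (1 : R).
have ry := is_derive_fM (is_derive_cst r2 y 1) id1.
have one := is_derive_cst (1 : R) y 1.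
have y2 := is_derive_fX 2 id1.
have a1 := is_derive_comp (is_derive1_atan _) (is_derive_fD ry one).
have a2 := is_derive_comp (is_derive1_atan _) (is_derive_fB ry one).
have l1 := is_derive_comp (g := fun y => y ^+ 2 - r2 * y + 1) (is_derive1_ln dm)
  (is_derive_fD (is_derive_fB y2 ry) one).
have l2 := is_derive_comp (g := fun y => y ^+ 2 + r2 * y + 1) (is_derive1_ln dp)
  (is_derive_fD (is_derive_fD y2 ry) one).
have := is_derive_fD
  (is_derive_fM (is_derive_cst ((2 * r2)^-1) y 1) (is_derive_fD a1 a2))
  (is_derive_fM (is_derive_cst ((4 * r2)^-1) y 1) (is_derive_fB l1 l2)).
move=> h; apply: is_derive_eq h _; rewrite /quartic /=.
have r0 : r2 != 0 by rewrite gt_eqF // r2_gt0.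
have E1 : 1 + (r2 * y + 1) ^+ 2 = 2 * (y ^+ 2 + r2 * y + 1).
  by rewrite sqrrD exprMn sqr_r2; ring.
have E2 : 1 + (r2 * y - 1) ^+ 2 = 2 * (y ^+ 2 - r2 * y + 1).
  by rewrite sqrrB exprMn sqr_r2; ring.
have E3 : 1 + y ^+ 4 = (y ^+ 2 + r2 * y + 1) * (y ^+ 2 - r2 * y + 1).
  have -> : (y ^+ 2 + r2 * y + 1) * (y ^+ 2 - r2 * y + 1) =
    1 + y ^+ 4 + 2 * y ^+ 2 - r2 ^+ 2 * y ^+ 2 by ring.
  by rewrite sqr_r2; ring.
rewrite E1 E2 E3.
have : y ^+ 2 + r2 * y + 1 != 0 by rewrite gt_eqF.
have : y ^+ 2 - r2 * y + 1 != 0 by rewrite gt_eqF.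
by move: r0; clear; move=> r0 h1 h2; field; rewrite r0 h1 h2.
Qed.

Lemma quartic2_bound z : 0 <= z -> `|quartic2 z| <= 48 / (1 + z) ^+ 2.
Proof.
move=> z0; have d := quartic_den_gt0 z.
have z4 : 0 <= z ^+ 4 by rewrite exprn_ge0.
have -> : quartic2 z = (2 - 24 * z ^+ 4 + 6 * z ^+ 4 ^+ 2) / (1 + z ^+ 4) ^+ 3.
  by rewrite /quartic2 -exprM.
rewrite normrM normfV (ger0_norm (x := _ ^+ 3)) ?exprn_ge0 ?(ltW d) //.
rewrite ler_pdivrMr ?exprn_gt0 // mulrAC ler_pdivlMr ?exprn_gt0 //; last by lra.
have z1 : (1 + z) ^+ 2 <= 4 * (1 + z ^+ 4).
  have -> : z ^+ 4 = z ^+ 2 ^+ 2 by rewrite -exprM.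
  by have := sqr_ge0 (z - 1); have := sqr_ge0 (z ^+ 2 - 1); nra.
have n : `|2 - 24 * z ^+ 4 + 6 * z ^+ 4 ^+ 2| <= 12 * (1 + z ^+ 4) ^+ 2.
  by rewrite ler_norml; nra.
have := ler_pM (normr_ge0 _) (sqr_ge0 (1 + z)) n z1.
by move/le_trans; apply; rewrite le_eqVlt; apply/orP; left; apply/eqP; ring.
Qed.

Lemma quartic_ge0 y : 0 <= quartic y.
Proof. by rewrite /quartic divr_ge0 ?sqr_ge0 // ltW // quartic_den_gt0. Qed.

Lemma quartic_le y : 0 <= y -> quartic y <= 4 / (1 + y) ^+ 2.
Proof.
move=> y0; have d := quartic_den_gt0 y.
rewrite /quartic ler_pdivrMr // mulrAC ler_pdivlMr ?exprn_gt0 //; last by lra.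
have -> : y ^+ 4 = y ^+ 2 ^+ 2 by rewrite -exprM.
by have := sqr_ge0 (y - 1); have := sqr_ge0 (y ^+ 2 - 1); nra.
Qed.

Lemma quartic_int0 : quartic_int 0 = 0.
Proof.
rewrite /quartic_int !mulr0 expr0n /= subr0 addr0 !add0r atanN.
by rewrite !subrr !mulr0 addr0.
Qed.

Let nat_pinfty H : 0 < H -> (n%:R * H) @[n --> \oo] --> +oo.
Proof.
move=> H0; apply/cvgryPge => A; near=> n.
rewrite -ler_pdivrMr //.
near: n; exact: nbhs_infty_ger.
Unshelve. all: by end_near. Qed.

Lemma cvg_inv_nat H : 0 < H -> ((n%:R * H)^-1) @[n --> \oo] --> (0 : R).
Proof.
move=> H0; apply/gtr0_cvgV0; last exact: nat_pinfty.
by near=> n; rewrite mulr_gt0 // ltr0n; near: n; exact: nbhs_infty_gt.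
Unshelve. all: by end_near. Qed.

(** At infinity the two arctangents contribute pi / 2 each. The logarithmic part
    is squeezed between - 4 r2 / y and 0. *)
Lemma cvg_quartic_int H : 0 < H ->
  quartic_int (n%:R * H) @[n --> \oo] --> pi / (2 * r2).
Proof.
move=> H0.
have rH : 0 < r2 * H by rewrite mulr_gt0 // r2_gt0.
have atan_lim (e : R) : atan (r2 * (n%:R * H) + e) @[n --> \oo] --> pi / 2.
  apply: (@cvg_comp _ _ _ (fun n : nat => r2 * (n%:R * H) + e) atan) (@cvgy_atan R).
  apply/cvgryPge => A; near=> n.
  rewrite -lerBlDr mulrCA -ler_pdivrMr //.
  near: n; exact: nbhs_infty_ger.
have ln_lim : ln ((n%:R * H) ^+ 2 - r2 * (n%:R * H) + 1) -
   ln ((n%:R * H) ^+ 2 + r2 * (n%:R * H) + 1) @[n --> \oo] --> (0 : R).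
  apply: (@squeeze_cvgr _ _ _ _ (fun n => - (4 * r2) * (n%:R * H)^-1) (cst 0)).
  - near=> n.
    set y := n%:R * H.
    have y0 : 0 < y.
      by rewrite /y mulr_gt0 // ltr0n; near: n; exact: nbhs_infty_gt.
    have a0 := den_minus_gt0 y; have b0 := den_plus_gt0 y.
    have ry : 0 < r2 * y by rewrite mulr_gt0 // r2_gt0.
    apply/andP; split; last first.
      by rewrite /= subr_le0 ler_ln ?posrE //; lra.
    rewrite mulNr lerNl opprB -ln_div ?posrE //.
    have -> : (y ^+ 2 + r2 * y + 1) / (y ^+ 2 - r2 * y + 1) =
      1 + 2 * r2 * y / (y ^+ 2 - r2 * y + 1).
      by field; rewrite gt_eqF.
    apply: le_trans (le_ln1Dx _) _.
      apply: lt_le_trans (_ : 0 <= _); first by rewrite ltrN10.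
      by rewrite divr_ge0 ?ltW // -mulrA; lra.
    rewrite ler_pdivrMr // [leRHS]mulrAC ler_pdivlMr //.
    have e : y ^+ 2 - r2 * y + 1 = (y ^+ 2) / 2 + (y - r2) ^+ 2 / 2 + (1 - r2 ^+ 2 / 2).
      by field.
    have : y ^+ 2 / 2 <= y ^+ 2 - r2 * y + 1.
      by rewrite e sqr_r2; have := sqr_ge0 (y - r2); lra.
    by have := r2_gt0; nra.
  - rewrite -[X in _ --> X](mulr0 (- (4 * r2))).
    by apply: cvgMl_tmp; exact: cvg_inv_nat.
  - exact: cvg_cst.
rewrite /quartic_int.
have -> : pi / (2 * r2) = (2 * r2)^-1 * (pi / 2 + pi / 2) + (4 * r2)^-1 * 0.
  by field; rewrite gt_eqF // r2_gt0.
apply: cvgD; last exact: cvgMl_tmp.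
by apply: cvgMl_tmp; apply: cvgD; exact: atan_lim.
Unshelve. all: by end_near. Qed.

Lemma quartic_series_bound H N : 0 < H ->
  series (fun i => 4 / (1 + i.+1%:R * H) ^+ 2) N <= 4 / H.
Proof.
move=> H0; have := sum_inv_sqr_step_le N (ltW H0).
rewrite -(ler_pM2l (_ : 0 < 4 / H)) ?divr_gt0 // mulr1.
move/(le_trans _); apply.
rewrite /series /= mulr_sumr; apply: ler_sum => i _.
by rewrite le_eqVlt mulrA mulfVK ?eqxx // gt_eqF.
Qed.

(** The end point correction at 0 of the trapezoidal rule vanishes because
    [quartic 0 = 0]: this is why the first error term is already of order
    H ^+ 2. *)
Lemma sum_quartic H : 0 < H ->
  exists2 T, series (fun i => quartic (i.+1%:R * H)) @ \oo --> T &
   `|H * T - pi / (2 * r2)| <= 24 * H ^+ 2 * (H + 1).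
Proof.
move=> H0.
have pos i : 0 <= i.+1%:R * H by rewrite mulr_ge0 // ltW.
have q_le i : `|quartic (i.+1%:R * H)| <= 4 / (1 + i.+1%:R * H) ^+ 2.
  by rewrite ger0_norm ?quartic_ge0 // quartic_le.
have [T cT _] := dominated_series q_le (fun N => quartic_series_bound N H0).
exists T => //.
have q0 : quartic (n%:R * H) @[n --> \oo] --> (0 : R).
  rewrite -(cvg_shiftS (fun n => quartic (n%:R * H))).
  by apply: cvg_series_cvg_0; apply/cvg_ex; exists T.
pose E n := quartic_int (n%:R * H) - quartic_int 0
   - H * series (fun i => quartic (i.+1%:R * H)) n
   + H / 2 * (quartic (n%:R * H) - quartic 0).
have E_le n : `|E n| <= 24 * H ^+ 2 * (H + 1).
  have := @trapezoid_sum R quartic_int quartic quartic1 quartic2 H 48 n (ltW H0) (ler0n _ _)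
    (fun z _ => is_derive_quartic_int z) (fun z _ => is_derive_quartic z)
    (fun z _ => is_derive_quartic1 z) quartic2_bound.
  by have -> : 48 / 2 = 24 :> R by field.
have : E n @[n --> \oo] --> pi / (2 * r2) - 0 - H * T + H / 2 * (0 - 0).
  rewrite /E quartic_int0.
  have -> : quartic 0 = 0 by rewrite /quartic expr0n mul0r.
  apply: cvgD.
    apply: cvgB; last exact: cvgMl_tmp.
    by apply: cvgB; [exact: cvg_quartic_int|exact: cvg_cst].
  by apply: cvgMl_tmp; apply: cvgB => //; exact: cvg_cst.
rewrite !subr0 mulr0 addr0 distrC => /cvg_norm cE.
rewrite -(cvg_lim _ cE) //; apply: limr_le; first by apply/cvg_ex; eexists; exact: cE.
exact: nearW.
Qed.

(** Twice the terms of even index minus all the terms; the terms of even index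
    form the sum of step 2 H, so that the two main terms cancel. *)
Lemma sum_alt_quartic H : 0 < H ->
  exists2 T, series (fun i => (-1) ^+ i.+1 * quartic (i.+1%:R * H)) @ \oo --> T &
   `|H * T| <= 24 * H ^+ 2 * (9 * H + 5).
Proof.
move=> H0.
have pos i : 0 <= i.+1%:R * H by rewrite mulr_ge0 // ltW.
have q_le i : `|(-1) ^+ i.+1 * quartic (i.+1%:R * H)| <= 4 / (1 + i.+1%:R * H) ^+ 2.
  rewrite normrM normrX normrN1 expr1n mul1r ger0_norm ?quartic_ge0 //.
  exact: quartic_le.
have [T cT _] := dominated_series q_le (fun N => quartic_series_bound N H0).
exists T => //.
have [T1 cT1 T1_le] := sum_quartic H0.
have H20 : 0 < 2 * H by rewrite mulr_gt0.
have [T2 cT2 T2_le] := sum_quartic H20.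
have dbl n : series (fun i => (-1) ^+ i.+1 * quartic (i.+1%:R * H)) n.*2 =
   2 * series (fun i => quartic (i.+1%:R * (2 * H))) n
   - series (fun i => quartic (i.+1%:R * H)) n.*2.
  rewrite /series /=; elim: n => [|n IH]; first by rewrite !big_geq // mulr0 subr0.
  rewrite doubleS !big_nat_recr //= IH.
  have -> : n.+1%:R * (2 * H) = n.*2.+2%:R * H.
    by rewrite mulrA -natrM muln2 doubleS.
  rewrite !exprS -signr_odd odd_double.
  by rewrite /=; ring.
have cvg_dbl (u : R^nat) (l : R) : u @ \oo --> l -> u n.*2 @[n --> \oo] --> l.
  move=> ul; apply: cvg_comp ul.
  apply/cvgnyPge => A; near=> n.
  rewrite -addnn; apply: (@leq_trans n); last exact: leq_addr.
  by near: n; exact: nbhs_infty_ge.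
have TE : T = 2 * T2 - T1.
  have := cvg_dbl _ _ cT.
  under eq_fun do rewrite dbl.
  move=> h; apply: (cvg_unique _ h) => //.
  apply: cvgB; first exact: cvgMl_tmp.
  exact: (cvg_dbl (series (fun i => quartic (i.+1%:R * H)))).
have -> : H * T = (2 * H * T2 - pi / (2 * r2)) - (H * T1 - pi / (2 * r2)).
  by rewrite TE; ring.
apply: le_trans (ler_normB _ _) _.
apply: le_trans (lerD T2_le T1_le) _.
rewrite le_eqVlt; apply/orP; left; apply/eqP; ring.
Unshelve. all: by end_near. Qed.

End Quartic.

(** * Bounded partial sums and the cubic kernel *)

Section BoundedSums.
Context {R : realType}.
Implicit Types f g : nat -> R.

(** Convergence of a series of nonnegative terms, in the form preserved by
    comparison, shifts of the index, and finite changes. *)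
Definition bounded_sums f := exists M : R, forall N, series f N <= M.

Lemma bounded_sums_le f g : (forall i, f i <= g i) ->
  bounded_sums g -> bounded_sums f.
Proof.
move=> fg [M gM]; exists M => N; apply: le_trans (gM N).
by apply: ler_sum.
Qed.

Lemma bounded_sumsD f g : bounded_sums f -> bounded_sums g ->
  bounded_sums (fun i => f i + g i).
Proof.
move=> [M fM] [M' gM]; exists (M + M') => N.
by rewrite /series /= big_split lerD //; [exact: fM|exact: gM].
Qed.

Lemma bounded_sumsZ (a : R) f : 0 <= a -> bounded_sums f ->
  bounded_sums (fun i => a * f i).
Proof.
move=> a0 [M fM]; exists (a * M) => N.
by rewrite /series /= -mulr_sumr ler_wpM2l //; exact: fM.
Qed.

Lemma bounded_sums_shift (k : nat) f : (forall i, 0 <= f i) ->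
  bounded_sums f -> bounded_sums (fun i => f (i + k)%N).
Proof.
move=> f0 [M fM]; exists M => N; apply: le_trans (fM (N + k)%N).
rewrite /series /= (@big_cat_nat _ _ _ k 0 (N + k)) //=; last by rewrite leq_addl.
rewrite -{3}[k]add0n big_addn addnK lerDr.
by apply: sumr_ge0.
Qed.

Lemma bounded_sums_unshift (k : nat) f : (forall i, 0 <= f i) ->
  bounded_sums (fun i => f (i + k)%N) -> bounded_sums f.
Proof.
move=> f0 [M fM]; exists (\sum_(0 <= i < k) f i + M) => N.
apply: le_trans (_ : \sum_(0 <= i < N + k) f i <= _).
  rewrite /series /= [leRHS](@big_cat_nat _ _ _ N) //=; last by rewrite leq_addr.
  by rewrite lerDl sumr_ge0.
rewrite (@big_cat_nat _ _ _ k) //=; last by rewrite leq_addl.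
rewrite lerD2l (_ : \sum_(k <= i < N + k) f i = \sum_(0 <= i < N) f (i + k)%N).
  exact: fM.
by rewrite -{1}[k]add0n big_addn addnK.
Qed.

Lemma bounded_sums_dist (k : nat) f : (forall i, 0 <= f i) ->
  bounded_sums (fun i => f i.+1) ->
  bounded_sums (fun i => f `|i.+1%:Z - k%:Z|%N).
Proof.
move=> f0 bf; apply: (@bounded_sums_unshift k) => //.
apply: bounded_sums_le bf => i.
by rewrite (_ : `|(i + k).+1%:Z - k%:Z|%N = i.+1) //; lia.
Qed.

End BoundedSums.

Section CubicKernel.
Context {R : realType}.
Implicit Types (x y w C N : R).

(** What remains of x after w ^+ 2 times the kernel x / (x ^+ 2 + w ^+ 2) has
    been subtracted, see [kernelE]. *)
Definition cubic_kernel (w x : R) : R := x ^+ 3 / (x ^+ 2 + w ^+ 2).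

Lemma kernelE w x : 0 < w ->
  x / (x ^+ 2 + w ^+ 2) = (w ^+ 2)^-1 * (x - cubic_kernel w x).
Proof.
move=> w0; rewrite /cubic_kernel.
have : x ^+ 2 + w ^+ 2 != 0 by rewrite gt_eqF // ltr_wpDl ?sqr_ge0 ?exprn_gt0.
by move=> h; field; rewrite h gt_eqF.
Qed.

(** The factor x^2 / (x^2 + w^2) increases with |x|, so |x| may be replaced by
    its bound. The result has the form N^3 / (N^2 + w^2), with the powers of C in
    front, which is what the weights below expect. *)
Lemma cubic_kernel_bound w x C N : 0 < w -> 1 <= C -> 0 <= N -> `|x| <= C * N ->
  `|cubic_kernel w x| <= C ^+ 3 * (N ^+ 3 / (N ^+ 2 + w ^+ 2)).
Proof.
move=> w0 C1 N0 xC.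
have w2 : 0 < w ^+ 2 by rewrite exprn_gt0.
have dx : 0 < x ^+ 2 + w ^+ 2 by rewrite ltr_wpDl ?sqr_ge0.
have dN : 0 < N ^+ 2 + w ^+ 2 by rewrite ltr_wpDl ?sqr_ge0.
rewrite /cubic_kernel normrM normfV (gtr0_norm dx) mulrA.
rewrite ler_pdivrMr // mulrAC ler_pdivlMr // normrX.
rewrite -(real_normK (num_real x)).
set X := `|x| in xC *; have X0 : 0 <= X by exact: normr_ge0.
have h3 : X ^+ 3 <= (C * N) ^+ 3 by rewrite ler_pXn2r ?nnegrE // mulr_ge0 //; lra.
have C0 : 0 <= C by lra.
rewrite !mulrDr; apply: lerD; last first.
  by rewrite -exprMn ler_wpM2r // sqr_ge0.
have -> : X ^+ 3 * N ^+ 2 = X * (X ^+ 2 * N ^+ 2) by ring.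
have -> : C ^+ 3 * N ^+ 3 * X ^+ 2 = (C ^+ 3 * N) * (X ^+ 2 * N ^+ 2) by ring.
apply: ler_wpM2r; first by rewrite mulr_ge0 // sqr_ge0.
apply: le_trans xC _; apply: ler_wpM2r => //.
by rewrite exprS ler_peMr // exprn_ege1.
Qed.

(** The difference quotient is a polynomial in m x, m y and r, where
    m z = z^2 / (z^2 + w^2) lies between 0 and 1 and r is dominated by the products
    m x (1 - m y) and m y (1 - m x). It keeps the small factor N^2 / (N^2 + w^2),
    which a bound by a constant would lose. *)
Lemma cubic_kernel_lip w x y C N : 0 < w -> 1 <= C -> 0 <= N ->
  `|x| <= C * N -> `|y| <= C * N ->
  `|cubic_kernel w x - cubic_kernel w y| <=
    4 * `|x - y| * C ^+ 2 * (N ^+ 2 / (N ^+ 2 + w ^+ 2)).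
Proof.
move=> w0 C1 N0 xC yC.
have C0 : 0 <= C by lra.
have w2 : 0 < w ^+ 2 by rewrite exprn_gt0.
have dN : 0 < N ^+ 2 + w ^+ 2 by rewrite ltr_wpDl ?sqr_ge0.
pose m z : R := z ^+ 2 / (z ^+ 2 + w ^+ 2).
have m_le z : `|z| <= C * N -> 0 <= m z <= C ^+ 2 * (N ^+ 2 / (N ^+ 2 + w ^+ 2)).
  move=> zC; have dz : 0 < z ^+ 2 + w ^+ 2 by rewrite ltr_wpDl ?sqr_ge0.
  apply/andP; split; first by rewrite divr_ge0 ?sqr_ge0 // ltW.
  have z2 : z ^+ 2 <= C ^+ 2 * N ^+ 2.
    by rewrite -exprMn -(real_normK (num_real z)) ler_sqr ?nnegrE ?mulr_ge0.
  rewrite /m mulrA ler_pdivrMr // mulrAC ler_pdivlMr // !mulrDr.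
  apply: lerD; last by rewrite ler_wpM2r // ltW.
  have -> : C ^+ 2 * N ^+ 2 * z ^+ 2 = C ^+ 2 * (z ^+ 2 * N ^+ 2) by ring.
  rewrite ler_peMl //; first by apply: mulr_ge0; exact: sqr_ge0.
  exact: exprn_ege1.
have m1 z : m z <= 1.
  have dz : 0 < z ^+ 2 + w ^+ 2 by rewrite ltr_wpDl ?sqr_ge0.
  by rewrite /m ler_pdivrMr // mul1r lerDl ltW.
have /andP[mx0 mx] := m_le x xC; have /andP[my0 my] := m_le y yC.
set B := C ^+ 2 * _ in mx my.
have dx : 0 < x ^+ 2 + w ^+ 2 by rewrite ltr_wpDl ?sqr_ge0.
have dy : 0 < y ^+ 2 + w ^+ 2 by rewrite ltr_wpDl ?sqr_ge0.
pose r := w ^+ 2 * x * y / ((x ^+ 2 + w ^+ 2) * (y ^+ 2 + w ^+ 2)).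
have r_le : `|r| <= (m x * (1 - m y) + m y * (1 - m x)) / 2.
  have -> : (m x * (1 - m y) + m y * (1 - m x)) / 2 =
     (w ^+ 2 * ((x ^+ 2 + y ^+ 2) / 2)) / ((x ^+ 2 + w ^+ 2) * (y ^+ 2 + w ^+ 2)).
    by rewrite /m; field; rewrite !gt_eqF.
  rewrite /r normrM normfV (gtr0_norm (x := (_ + _) * _)) ?mulr_gt0 //.
  rewrite ler_pM2r ?invr_gt0 ?mulr_gt0 // -mulrA normrM (gtr0_norm w2).
  rewrite ler_pM2l // ler_norml.
  by have := sqr_ge0 (x - y); have := sqr_ge0 (x + y); nra.
have -> : cubic_kernel w x - cubic_kernel w y =
  (x - y) * (m x * m y + (m x * (1 - m y) + m y * (1 - m x)) + r).
  by rewrite /cubic_kernel /m /r; field; rewrite !gt_eqF.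
rewrite normrM.
have -> : 4 * `|x - y| * C ^+ 2 * (N ^+ 2 / (N ^+ 2 + w ^+ 2)) = `|x - y| * (4 * B).
  by rewrite /B; ring.
apply: ler_wpM2l => //.
have := m1 x; have := m1 y; move: r_le mx my mx0 my0.
move: (m x) (m y) => a b; rewrite ler_norml => /andP[r1 r2'] aB bB a0 b0 b1 a1.
rewrite ler_norml; apply/andP; split; nra.
Qed.

End CubicKernel.

(** * Coefficients of the affine part *)

Section AffineCoefficients.
Context {R : realType}.

(** The sine coefficients of the affine function with values [al] at 0 and [be]
    at 1, see [sine_coef_chord]. *)
Definition affine_coef (al be : R) (n : nat) : R :=
  Num.sqrt 2 / (n%:R * pi) * (al - (-1) ^+ n * be).

(** At index 0 the value is 0, so the sums over |n - k| need no exception for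
    n = k. *)
Definition over_index (f : nat -> R) (n : nat) : R := f n / n%:R.

Definition corr (k : nat) (f g : nat -> R) (n : nat) : R :=
  f n * (g (n + k)%N + g `|n%:Z - k%:Z|%N).

Lemma over_index0 f : over_index f 0%N = 0.
Proof. by rewrite /over_index invr0 mulr0. Qed.

Lemma corr_le (k : nat) (f g f' g' : nat -> R) n :
  (forall m, `|f m| <= f' m) -> (forall m, `|g m| <= g' m) ->
  `|corr k f g n| <= corr k f' g' n.
Proof.
move=> ff' gg'; rewrite /corr normrM ler_pM //.
by apply: le_trans (ler_normD _ _) _; apply: lerD.
Qed.

Lemma affine_over_index_bound al be n :
  `|over_index (affine_coef al be) n| <= (Num.sqrt 2 * (`|al| + `|be|)) / n%:R ^+ 2.
Proof.
case: n => [|n]; first by rewrite over_index0 normr0 expr0n invr0 mulr0.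
rewrite /over_index /affine_coef.
have pi1 : 1 <= pi :> R by have := @pi_ge2 R; lra.
have n0 : 0 < n.+1%:R :> R by rewrite ltr0n.
have -> : Num.sqrt 2 / (n.+1%:R * pi) * (al - (-1) ^+ n.+1 * be) / n.+1%:R =
  (Num.sqrt 2 * ((al - (-1) ^+ n.+1 * be) / pi)) / n.+1%:R ^+ 2.
  have pn0 : pi != 0 :> R by rewrite gt_eqF // pi_gt0.
  by move: pn0 n0 { pi1 }; move: (n.+1%:R : R) (pi : R) => x p p0 x0; field; rewrite p0 gt_eqF.
rewrite normrM normfV (gtr0_norm (x := _ ^+ 2)) ?exprn_gt0 //.
rewrite ler_pM2r ?invr_gt0 ?exprn_gt0 // normrM ger0_norm ?sqrtr_ge0 //.
rewrite ler_wpM2l ?sqrtr_ge0 // normrM normfV (gtr0_norm (x := pi)); last by lra.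
rewrite ler_pdivrMr; last by lra.
apply: le_trans (_ : `|al| + `|be| <= _); last by rewrite ler_peMr // addr_ge0.
apply: le_trans (ler_normB _ _) _; rewrite lerD2l.
by rewrite normrM normrX normrN1 expr1n mul1r.
Qed.

(** The leading part, of size n^-4, of the products of affine coefficients. All
    the signs reduce to (-1)^n and (-1)^k since n, n + k and n - k enter only through
    their parities. *)
Definition corr_main (k : nat) (al be : R) (n : nat) : R :=
  4 / pi ^+ 2 * (al ^+ 2 + (-1) ^+ k * be ^+ 2
     - (-1) ^+ n * (al * be * (1 + (-1) ^+ k))) / n%:R ^+ 4.

Lemma corr_main_bound k al be n : `|corr_main k al be n| <=
  4 / pi ^+ 2 * (`|al| + `|be|) ^+ 2 / n%:R ^+ 4.
Proof.
have p0 : 0 < pi :> R := pi_gt0 R.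
rewrite /corr_main normrM normfV (ger0_norm (x := _ ^+ 4)) ?exprn_ge0 //.
rewrite ler_wpM2r ?invr_ge0 ?exprn_ge0 // normrM (ger0_norm (x := 4 / _)); last first.
  by rewrite divr_ge0 // exprn_ge0 // ltW.
rewrite ler_wpM2l ?divr_ge0 ?exprn_ge0 ?(ltW p0) //.
have nb m : `|(-1) ^+ m : R| = 1 by rewrite normrX normrN1 expr1n.
apply: le_trans (ler_normB _ _) _.
apply: le_trans (lerD (ler_normD _ _) (lexx _)) _.
rewrite !normrM !nb !mul1r.
have : `|1 + (-1) ^+ k| <= 2 :> R.
  by apply: le_trans (ler_normD _ _) _; rewrite nb normr1; lra.
have := normr_ge0 al; have := normr_ge0 be.
move: (`|al|) (`|be|) (`|1 + _|) => a b e b0 a0 e2.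
have ab0 : 0 <= a * b by exact: mulr_ge0.
have : a * b * e <= a * b * 2 by exact: ler_wpM2l.
by nra.
Qed.

Lemma index_le (k n m : nat) : (0 < n)%N -> (0 < m)%N ->
  m = (n + k)%N \/ m = `|n%:Z - k%:Z|%N ->
  n%:R <= k.+1%:R * m%:R :> R.
Proof. by move=> n0 m0 [mE|mE]; rewrite -natrM ler_nat; subst m; nia. Qed.

(** The difference with the leading part is n^-4 times a quantity of order
    y^2 / x^2, because (x + y)^-2 + (x - y)^-2 - 2 x^-2 has no term of order
    x^-3. The letters stand for n, k, pi, sqrt 2, al, be, (-1)^n and (-1)^k. *)
Lemma corr_affine_identity (x y p r a b e f : R) :
  x != 0 -> p != 0 -> x + y != 0 -> x - y != 0 -> e ^+ 2 = 1 -> r ^+ 2 = 2 ->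
  r / (x * p) * (a - e * b) / x *
    (r / ((x + y) * p) * (a - e * f * b) / (x + y) +
     r / ((x - y) * p) * (a - e * f * b) / (x - y))
  - 4 / p ^+ 2 * (a ^+ 2 + f * b ^+ 2 - e * (a * b * (1 + f))) / x ^+ 4 =
  4 / p ^+ 2 * (a ^+ 2 + f * b ^+ 2 - e * (a * b * (1 + f))) / x ^+ 4 *
    ((3 * x ^+ 2 * y ^+ 2 - y ^+ 4) / (x ^+ 2 - y ^+ 2) ^+ 2).
Proof.
move=> x0 p0 xy0 xmy0 e2 r2.
have -> : a ^+ 2 + f * b ^+ 2 - e * (a * b * (1 + f)) =
    (a - e * b) * (a - e * f * b).
  transitivity (a ^+ 2 + e ^+ 2 * f * b ^+ 2 - e * (a * b * (1 + f))); last by ring.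
  by rewrite e2 mul1r.
move: (a - e * b) (a - e * f * b) => u v.
transitivity (r ^+ 2 * (u * v) / (p ^+ 2 * x ^+ 2) * ((x + y) ^- 2 + (x - y) ^- 2)
  - 4 / p ^+ 2 * (u * v) / x ^+ 4).
  by congr (_ - _); field; rewrite x0 p0 xy0 xmy0.
have -> : x ^+ 2 - y ^+ 2 = (x - y) * (x + y) by ring.
by rewrite r2; field; rewrite x0 p0 xy0 xmy0.
Qed.

(** For n > k this is [corr_affine_identity]; the finitely many other indices only
    enlarge the constant. *)
Lemma corr_affine_rest (k : nat) al be : (0 < k)%N ->
  exists2 C, 0 <= C & forall n, (0 < n)%N ->
  `|corr k (over_index (affine_coef al be)) (over_index (affine_coef al be)) n
    - corr_main k al be n| <= C / n%:R ^+ 6.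
Proof.
move=> k0.
set P := over_index _.
have p0 : 0 < pi :> R := pi_gt0 R.
pose Q : R := Num.sqrt 2 * (`|al| + `|be|).
have Q0 : 0 <= Q by rewrite mulr_ge0 ?sqrtr_ge0 // addr_ge0.
pose A : R := 4 / pi ^+ 2 * (`|al| + `|be|) ^+ 2.
have A0 : 0 <= A by rewrite mulr_ge0 ?sqr_ge0 // divr_ge0 // sqr_ge0.
pose C1 := A * (3 * k%:R ^+ 2 * k.+1%:R ^+ 2).
have C10 : 0 <= C1 by rewrite mulr_ge0 // !mulr_ge0 // sqr_ge0.
pose C2 := (Q * (Q + Q) + A) * k%:R ^+ 6.
have QA0 : 0 <= Q * (Q + Q) + A.
  by apply: addr_ge0 => //; apply: mulr_ge0 => //; exact: addr_ge0.
have C20 : 0 <= C2 by apply: mulr_ge0 => //; exact: exprn_ge0.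
exists (C1 + C2); first exact: addr_ge0.
move=> n n0; have n0' : 0 < n%:R :> R by rewrite ltr0n.
(* For n <= k every factor is bounded and n^-6 >= k^-6. *)
have [nk|kn] := leqP n k.
  have P_le m : `|P m| <= Q.
    apply: le_trans (affine_over_index_bound al be m) _; rewrite -/Q.
    case: m => [|m]; first by rewrite expr0n invr0 mulr0.
    by rewrite ler_piMr // invf_le1 ?exprn_gt0 ?ltr0n // exprn_ege1 // ler1n.
  apply: le_trans (_ : Q * (Q + Q) + A <= _).
    apply: le_trans (ler_normB _ _) _; apply: lerD.
      exact: (@corr_le k P P (fun=> Q) (fun=> Q)).
    apply: le_trans (corr_main_bound k al be n) _; rewrite -/A.
    by rewrite ler_piMr // invf_le1 ?exprn_gt0 // exprn_ege1 // ler1n.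
  rewrite ler_pdivlMr ?exprn_gt0 //.
  apply: le_trans (_ : C2 <= _); last by rewrite lerDr.
  apply: ler_wpM2l => //.
  by apply: lerXn2r; rewrite ?nnegrE ?ler0n // ler_nat.
have distE : `|n%:Z - k%:Z|%N = (n - k)%N by lia.
have nkR : (n - k)%:R = n%:R - k%:R :> R by rewrite natrB // ltnW.
have k0' : 0 < k%:R :> R by rewrite ltr0n.
have kn' : k%:R < n%:R :> R by rewrite ltr_nat.
set x : R := n%:R in n0' kn' nkR *; set y : R := k%:R in k0' kn' nkR *.
have sgnD : (-1) ^+ (n + k) = (-1) ^+ n * (-1) ^+ k :> R by rewrite exprD.
have sgnB : (-1) ^+ (n - k) = (-1) ^+ n * (-1) ^+ k :> R.
  by rewrite -{2}(subnK (ltnW kn)) exprD -mulrA -expr2 exprAC sqrrN !expr1n mulr1.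
have sn : ((-1) ^+ n) ^+ 2 = 1 :> R by rewrite exprAC sqrrN !expr1n.
have s2 : Num.sqrt 2 ^+ 2 = 2 :> R by rewrite sqr_sqrtr.
have E : corr k P P n - corr_main k al be n =
  corr_main k al be n * ((3 * x ^+ 2 * y ^+ 2 - y ^+ 4) / (x ^+ 2 - y ^+ 2) ^+ 2).
  rewrite /corr distE /P /over_index /affine_coef /corr_main sgnD sgnB natrD nkR -/x -/y.
  by apply: corr_affine_identity => //; rewrite gt_eqF //; lra.
rewrite E normrM.
have ge1 : x ^+ 2 / k.+1%:R <= x ^+ 2 - y ^+ 2.
  have -> : x ^+ 2 - y ^+ 2 = (x + y) * (x - y) by ring.
  have i1 : x <= k.+1%:R * (x - y).
    rewrite -nkR; apply: index_le => //; first by rewrite subn_gt0.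
    by right; rewrite distE.
  rewrite ler_pdivrMr // ?ltr0n // -mulrA [_ * k.+1%:R]mulrC expr2.
  by apply: ler_pM => //; lra.
have dpos : 0 < x ^+ 2 / k.+1%:R by rewrite divr_gt0 ?exprn_gt0 ?ltr0n.
have num : `|3 * x ^+ 2 * y ^+ 2 - y ^+ 4| <= 3 * x ^+ 2 * y ^+ 2.
  have x2 : y ^+ 2 <= x ^+ 2 by rewrite ler_sqr ?nnegrE; lra.
  have y2 : 0 <= y ^+ 2 by exact: sqr_ge0.
  rewrite (_ : y ^+ 4 = y ^+ 2 * y ^+ 2); last by ring.
  by rewrite ler_norml; nra.
have frac : `|(3 * x ^+ 2 * y ^+ 2 - y ^+ 4) / (x ^+ 2 - y ^+ 2) ^+ 2| <=
    3 * y ^+ 2 * k.+1%:R ^+ 2 / x ^+ 2.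
  rewrite normrM normfV (ger0_norm (x := _ ^+ 2)) ?sqr_ge0 //.
  have -> : 3 * y ^+ 2 * k.+1%:R ^+ 2 / x ^+ 2 =
     3 * x ^+ 2 * y ^+ 2 / (x ^+ 2 / k.+1%:R) ^+ 2.
    by field; rewrite !gt_eqF // ltr0n.
  apply: ler_pM => //.
    by rewrite invr_ge0 sqr_ge0.
  rewrite lef_pV2 ?posrE ?exprn_gt0 //; last exact: lt_le_trans ge1.
  by rewrite ler_sqr ?nnegrE // ltW //; exact: lt_le_trans ge1.
apply: le_trans (ler_pM (normr_ge0 _) (normr_ge0 _) (corr_main_bound k al be n) frac) _.
rewrite -/A -/x -/y.
have -> : A / x ^+ 4 * (3 * y ^+ 2 * k.+1%:R ^+ 2 / x ^+ 2) = C1 / x ^+ 6.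
  by rewrite /C1 -/y; field; rewrite gt_eqF.
by rewrite ler_wpM2r ?invr_ge0 ?exprn_ge0 ?(ltW n0') // lerDl.
Qed.

End AffineCoefficients.

(** * Weights for the square-summable part *)

Section SquareSummableWeights.
Context {R : realType}.

Section Weights.
Context (s : R).
Context (s0 : 1 / 2 < s) (s2 : s <= 2).
Context (h y : R) (n : nat).
Context (h0 : 0 < h) (h1 : h <= 1) (n0 : (0 < n)%N) (yE : y = n%:R * h).

Let y0 : 0 < y. Proof. by rewrite yE mulr_gt0 // ltr0n. Qed.
Let nE : n%:R = y / h. Proof. by rewrite yE mulfK // gt_eqF. Qed.

Let den : n%:R ^+ 4 + (h ^- 2) ^+ 2 = (1 + y ^+ 4) / h ^+ 4.
Proof. by rewrite nE; field; rewrite gt_eqF. Qed.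

Lemma one_plus_pow4 : (1 + y) ^+ 4 <= 8 * (1 + y ^+ 4).
Proof.
have : (1 + y) ^+ 2 <= 2 * (1 + y ^+ 2) by have := sqr_ge0 (y - 1); nra.
have e4 : y ^+ 4 = y ^+ 2 ^+ 2 by rewrite -exprM.
have -> : (1 + y) ^+ 4 = (1 + y) ^+ 2 ^+ 2 by rewrite -exprM.
move=> a; apply: le_trans (_ : (2 * (1 + y ^+ 2)) ^+ 2 <= _).
  by rewrite ler_sqr ?nnegrE ?sqr_ge0 // mulr_ge0 // addr_ge0 // sqr_ge0.
by rewrite e4; have := sqr_ge0 (y ^+ 2 - 1); nra.
Qed.

Let d4 : 0 < 1 + y ^+ 4.
Proof. by rewrite ltr_wpDr // exprn_ge0 // ltW. Qed.

Let powN : n%:R `^ (- (s + 1)) = y `^ (- (s + 1)) * h `^ (s + 1).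
Proof.
rewrite nE powRM ?invr_ge0 ?(ltW h0) ?(ltW y0) //.
by rewrite -(powR_inv1 (ltW h0)) -powRrM mulN1r opprK.
Qed.

Let pow_y (a b : R) (m m' : nat) : m%:R = a + b -> 0 <= b <= m'%:R ->
  y `^ (- a) * y ^+ m <= (1 + y) ^+ m'.
Proof.
move=> ab /andP[b0 bm].
rewrite -powR_mulrn ?(ltW y0) // -powRD ?(gt_eqF y0) ?implybT //.
have -> : - a + m%:R = b by lra.
apply: le_trans (_ : (1 + y) `^ b <= _).
  by apply: ge0_ler_powR => //; rewrite ?nnegrE; have := y0; lra.
rewrite -powR_mulrn; last by have := y0; lra.
by apply: ler_powR => //; have := y0; lra.
Qed.

(** In the variable y = n h, the left side is h^(s+1) y^(3-s) / (1 + y^4): the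
    factor for a product of an affine coefficient and a coefficient c. It is square
    summable over n, with a sum of order h^(2s+1). *)
Lemma cross_weight :
  n%:R `^ (- (s + 1)) * (n%:R ^+ 4 / (n%:R ^+ 4 + (h ^- 2) ^+ 2))
   <= 8 * h `^ (s + 1) / (1 + y).
Proof.
have y1 : 0 < 1 + y by have := y0; lra.
have H0 := powR_gt0 (s + 1) h0.
rewrite den powN nE.
have -> : y `^ (- (s + 1)) * h `^ (s + 1) * ((y / h) ^+ 4 / ((1 + y ^+ 4) / h ^+ 4))
  = h `^ (s + 1) * (y `^ (- (s + 1)) * y ^+ 4 / (1 + y ^+ 4)).
  by field; rewrite !gt_eqF //.
have -> : 8 * h `^ (s + 1) / (1 + y) = h `^ (s + 1) * (8 / (1 + y)) by ring.
rewrite ler_pM2l // ler_pdivrMr // mulrAC ler_pdivlMr //.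
have p3 : y `^ (- (s + 1)) * y ^+ 4 <= (1 + y) ^+ 3.
  by apply: (@pow_y _ (3 - s)); [ring|apply/andP; split; have := s2; have := s0; lra].
apply: le_trans one_plus_pow4.
rewrite [leRHS]exprSr; apply: ler_wpM2r => //; exact: ltW.
Qed.

(** In the variable y = n h, the left side is h^(2s) y^(4-2s) / (1 + y^4): the
    factor for a product of two coefficients c, uniformly small in n. The exponent
    2 s is at least s + 1/2 because s >= 1/2. *)
Lemma square_weight :
  (n%:R `^ (- (s + 1))) ^+ 2 * (n%:R ^+ 6 / (n%:R ^+ 4 + (h ^- 2) ^+ 2))
   <= 8 * h `^ (s + 1 / 2).
Proof.
have H0 := powR_gt0 (s + 1) h0.
rewrite den powN nE.
have -> : (y `^ (- (s + 1)) * h `^ (s + 1)) ^+ 2 * ((y / h) ^+ 6 / ((1 + y ^+ 4) / h ^+ 4))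
  = (h `^ (s + 1)) ^+ 2 / h ^+ 2 * ((y `^ (- (s + 1))) ^+ 2 * y ^+ 6 / (1 + y ^+ 4)).
  by field; rewrite !gt_eqF //.
have -> : (h `^ (s + 1)) ^+ 2 / h ^+ 2 = h `^ (2 * s).
  rewrite -exprVn -exprMn powRD ?(gt_eqF h0) ?implybT // powRr1 ?ltW //.
  by rewrite mulfK ?gt_eqF // -powR_mulrn ?powR_ge0 // -powRrM mulrC.
have hs : h `^ (2 * s) <= h `^ (s + 1 / 2).
  by apply: ger_powR; [rewrite h0 h1|have := s0; lra].
rewrite [leRHS]mulrC; apply: ler_pM; rewrite ?powR_ge0 //.
  by rewrite divr_ge0 ?(ltW d4) // mulr_ge0 ?sqr_ge0 // exprn_ge0 // ltW.
rewrite ler_pdivrMr //; apply: le_trans one_plus_pow4.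
rewrite -powR_mulrn ?powR_ge0 // -powRrM mulNr.
by apply: (@pow_y _ (4 - 2 * s)); [ring|apply/andP; split; have := s2; have := s0; lra].
Qed.

End Weights.
End SquareSummableWeights.

(** * Terms involving the square-summable part *)

Section SquareSummablePart.
Context {R : realType}.

Lemma lambda2_scale_ge1 (k : nat) : 1 <= pi ^+ 2 * (1 + k%:R ^+ 2) :> R.
Proof.
have pi1 : 1 <= pi :> R by have := @pi_ge2 R; lra.
have : 1 <= pi ^+ 2 :> R by exact: exprn_ege1.
by have := sqr_ge0 (k%:R : R); nra.
Qed.

Lemma lambda2_bound (k n : nat) : (0 < n)%N ->
  `|lambda2 R n k| <= pi ^+ 2 * (1 + k%:R ^+ 2) * n%:R ^+ 2.
Proof.
move=> n0; rewrite /lambda2 /lambda !exprMn.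
have n1 : 1 <= n%:R ^+ 2 :> R by rewrite exprn_ege1 // ler1n.
have k2 := sqr_ge0 (k%:R : R); have p2 := sqr_ge0 (pi : R).
move: n1 k2 p2; move: (n%:R ^+ 2) (k%:R ^+ 2) (pi ^+ 2) => x y p x1 y0 p0.
have xp : 0 <= x * p by apply: mulr_ge0 => //; lra.
have yp : 0 <= y * p by exact: mulr_ge0.
have yxp : y * p <= y * p * x by rewrite ler_peMr.
by rewrite ler_norml; apply/andP; split; lra.
Qed.

Lemma lambda_bound (k n : nat) : (0 < n)%N ->
  `|lambda R n| <= pi ^+ 2 * (1 + k%:R ^+ 2) * n%:R ^+ 2.
Proof.
move=> n0; rewrite /lambda ger0_norm ?sqr_ge0 // exprMn mulrC.
rewrite ler_wpM2r ?sqr_ge0 // ler_peMr ?sqr_ge0 //.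
by rewrite lerDl sqr_ge0.
Qed.

Section RestBounds.
Context (k : nat) (al be s : R) (c : nat -> R).
Context (s0 : 1 / 2 < s) (s2 : s <= 2).
Context (hc : bounded_sums (fun i => (i.+1%:R `^ s * c i.+1) ^+ 2)).

Let P := over_index (affine_coef al be).
Let D := over_index c.

(** The products in [corr k (P + D) (P + D)] that contain D at least once, where P
    comes from the affine part and D from c. *)
Definition corr_rest (n : nat) : R :=
  corr k P D n + corr k D P n + corr k D D n.

Definition weighted (n : nat) : R := n%:R `^ s * `|c n|.

(** One square-summable sequence that dominates the three coefficients met at
    index n. *)
Definition weighted3 (n : nat) : R :=
  weighted n + weighted (n + k)%N + weighted `|n%:Z - k%:Z|%N.

Lemma weighted_ge0 n : 0 <= weighted n.
Proof. by rewrite /weighted mulr_ge0 // powR_ge0. Qed.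

Lemma weighted3_ge0 n : 0 <= weighted3 n.
Proof. by rewrite /weighted3 !addr_ge0 // weighted_ge0. Qed.

Lemma bounded_weighted3 : bounded_sums (fun i => weighted3 i.+1 ^+ 2).
Proof.
have b1 : bounded_sums (fun i => weighted i.+1 ^+ 2).
  apply: bounded_sums_le hc => i.
  by rewrite /weighted !exprMn real_normK ?num_real.
have b2 : bounded_sums (fun i => weighted (i + k).+1 ^+ 2).
  by apply: (@bounded_sums_shift R k (fun i => weighted i.+1 ^+ 2)) => // i; exact: sqr_ge0.
have b3 : bounded_sums (fun i => weighted `|i.+1%:Z - k%:Z|%N ^+ 2).
  by apply: (@bounded_sums_dist R k (fun i => weighted i ^+ 2)) => // i; exact: sqr_ge0.
apply: bounded_sums_le (bounded_sumsZ (ler0n _ 3) (bounded_sumsD (bounded_sumsD b1 b2) b3)).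
move=> i; rewrite /weighted3 addSn.
move: (weighted _) (weighted _) (weighted _) => x y z.
have := sqr_ge0 (x - y); have := sqr_ge0 (y - z); have := sqr_ge0 (x - z).
by nra.
Qed.

(** The indices n + k and |n - k|, when positive, are at least n / (k + 1), so their
    weights compare with the weight of n. The same holds for
    [affine_shifted_bound]. *)
Lemma perturbation_shifted_bound n m : (0 < n)%N -> n%:R <= k.+1%:R * m%:R :> R ->
  `|D m| <= k.+1%:R ^+ 3 * weighted m * n%:R `^ (- (s + 1)).
Proof.
move=> n0; case: m => [|m].
  by rewrite mulr0 lern0 => /eqP nE; move: n0; rewrite nE.
move=> nm; rewrite /D /over_index /weighted normrM normfV normr_nat.
have n0' : 0 < n%:R :> R by rewrite ltr0n.
have m0 : 0 < m.+1%:R :> R by rewrite ltr0n.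
have k0 : 0 < k.+1%:R :> R by rewrite ltr0n.
have -> : `|c m.+1| / m.+1%:R =
   m.+1%:R `^ s * `|c m.+1| * m.+1%:R `^ (- (s + 1)).
  rewrite opprD powRD ?(gt_eqF m0) ?implybT // powRN powR_inv1 ?(ltW m0) //.
  by field; rewrite !gt_eqF // powR_gt0.
rewrite -[leRHS]mulrA [leRHS]mulrCA; apply: ler_wpM2l; first exact: weighted_ge0.
rewrite !powRN ler_pdivlMr ?powR_gt0 // mulrC ler_pdivrMr ?powR_gt0 //.
apply: le_trans (_ : (k.+1%:R * m.+1%:R) `^ (s + 1) <= _).
  by apply: ge0_ler_powR => //; rewrite ?nnegrE ?mulr_ge0 //; have := s0; lra.
rewrite powRM // ler_wpM2r ?powR_ge0 // -powR_mulrn //.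
by apply: ler_powR; [rewrite ler1n|have := s2; lra].
Qed.

Lemma affine_shifted_bound n m : (0 < n)%N -> n%:R <= k.+1%:R * m%:R :> R ->
  `|P m| <= Num.sqrt 2 * (`|al| + `|be|) * k.+1%:R ^+ 3 / n%:R ^+ 2.
Proof.
move=> n0; case: m => [|m].
  by rewrite mulr0 lern0 => /eqP nE; move: n0; rewrite nE.
move=> nm; apply: le_trans (affine_over_index_bound al be _) _.
have n0' : 0 < n%:R :> R by rewrite ltr0n.
have m0 : 0 < m.+1%:R :> R by rewrite ltr0n.
have k1 : 1 <= k.+1%:R :> R by rewrite ler1n.
set Q := Num.sqrt 2 * _; rewrite -[leRHS]mulrA; apply: ler_wpM2l.
  by rewrite mulr_ge0 ?sqrtr_ge0 // addr_ge0.
rewrite ler_pdivlMr ?exprn_gt0 // mulrC ler_pdivrMr ?exprn_gt0 //.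
apply: le_trans (_ : (k.+1%:R * m.+1%:R) ^+ 2 <= _).
  by rewrite ler_sqr ?nnegrE // ?mulr_ge0 // ltW.
rewrite exprMn ler_wpM2r ?sqr_ge0 //.
by rewrite [leRHS]exprS ler_peMl // sqr_ge0.
Qed.

Lemma corr_rest_bound n : (0 < n)%N ->
  `|corr_rest n| <= k.+1%:R ^+ 3 *
    (2 * (Num.sqrt 2 * (`|al| + `|be|)) *
       (weighted3 n * (n%:R `^ (- (s + 1)) / n%:R ^+ 2)) +
     weighted3 n ^+ 2 * (n%:R `^ (- (s + 1))) ^+ 2).
Proof.
move=> n0; have n0' : 0 < n%:R :> R by rewrite ltr0n.
set K3 := k.+1%:R ^+ 3; set nu := n%:R `^ _.
set Q := Num.sqrt 2 * _.
have nu0 : 0 <= nu by exact: powR_ge0.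
have K31 : 1 <= K3 :> R by rewrite exprn_ege1 // ler1n.
have K30 : 0 <= K3 by apply: le_trans K31.
have Q0 : 0 <= Q by rewrite mulr_ge0 ?sqrtr_ge0 // addr_ge0.
have idx m : m = (n + k)%N \/ m = `|n%:Z - k%:Z|%N ->
   `|D m| <= K3 * weighted m * nu /\ `|P m| <= Q * K3 / n%:R ^+ 2.
  case: m => [|m] mE.
    rewrite /D /P !over_index0 normr0; split.
      by apply: mulr_ge0 => //; apply: mulr_ge0 => //; exact: weighted_ge0.
    by apply: divr_ge0; [exact: mulr_ge0|exact: exprn_ge0].
  have nm := @index_le R k n m.+1 n0 isT mE.
  by split; [exact: perturbation_shifted_bound|exact: affine_shifted_bound].
have [Dp Pp] := idx (n + k)%N (or_introl erefl).
have [Dm Pm] := idx `|n%:Z - k%:Z|%N (or_intror erefl).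
rewrite /corr_rest /corr /weighted3.
set m := `|n%:Z - k%:Z|%N in Dm Pm *.
have Dn : `|D n| <= weighted n * nu.
  rewrite /D /over_index normrM normfV normr_nat /weighted /nu.
  rewrite le_eqVlt; apply/orP; left; apply/eqP.
  rewrite opprD powRD ?(gt_eqF n0') ?implybT // powRN powR_inv1 ?(ltW n0') //.
  by field; rewrite !gt_eqF // powR_gt0.
have Pn : `|P n| <= Q / n%:R ^+ 2 by exact: affine_over_index_bound.
have i2 : 0 <= (n%:R ^+ 2)^-1 :> R by rewrite invr_ge0 exprn_ge0.
have t0 := weighted_ge0 n; have tp0 := weighted_ge0 (n + k)%N.
have tm0 := weighted_ge0 m.
move: (weighted n) (weighted (n + k)%N) (weighted m) t0 tp0 tm0 Dp Pp Dm Pm Dn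
  => t tp tm t0 tp0 tm0 Dp Pp Dm Pm Dn.
move: (P n) (P (n + k)%N) (P m) (D n) (D (n + k)%N) (D m) Pn Pp Pm Dn Dp Dm
  => pn pp pm dn dp dm Pn Pp Pm Dn Dp Dm.
move: nu0 i2 Pn Pp Pm Dn Dp Dm; rewrite -/Q.
move: (nu) ((n%:R ^+ 2)^-1) => v i v0 i0 Pn Pp Pm Dn Dp Dm.
have dsum : `|dp + dm| <= K3 * (tp + tm) * v.
  apply: le_trans (ler_normD _ _) _.
  have -> : K3 * (tp + tm) * v = K3 * tp * v + K3 * tm * v by ring.
  exact: lerD.
have psum : `|pp + pm| <= 2 * (Q * K3 * i).
  apply: le_trans (ler_normD _ _) _; rewrite mulr_natl mulr2n.
  exact: lerD.
apply: le_trans (ler_normD _ _) _.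
apply: le_trans (lerD (ler_normD _ _) (lexx _)) _.
rewrite 3!normrM.
have h1 := ler_pM (normr_ge0 _) (normr_ge0 _) Pn dsum.
have h2 := ler_pM (normr_ge0 _) (normr_ge0 _) Dn psum.
have h3 := ler_pM (normr_ge0 _) (normr_ge0 _) Dn dsum.
apply: le_trans (lerD (lerD h1 h2) h3) _.
have q1 : 0 <= K3 * Q * v * i by rewrite !mulr_ge0.
have q2 : 0 <= K3 * v ^+ 2 by rewrite mulr_ge0 // sqr_ge0.
have -> : Q * i * (K3 * (tp + tm) * v) + t * v * (2 * (Q * K3 * i)) +
    t * v * (K3 * (tp + tm) * v) =
  (K3 * Q * v * i) * (2 * t + tp + tm) + (K3 * v ^+ 2) * (t * (tp + tm)) by ring.
have -> : K3 * (2 * Q * ((t + tp + tm) * (v * i)) + (t + tp + tm) ^+ 2 * v ^+ 2) =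
  (K3 * Q * v * i) * (2 * (t + tp + tm)) + (K3 * v ^+ 2) * (t + tp + tm) ^+ 2 by ring.
by apply: lerD; apply: ler_wpM2l => //; nra.
Qed.

Let Cx : R := pi ^+ 2 * (1 + k%:R ^+ 2).

(** For the cross terms, with T the weighted coefficient and z = h^(1/2) / y,
    8 T z <= T^2 + 16 z^2 replaces the Cauchy-Schwarz inequality term by term; both
    squares are summable, uniformly in h after the factor h^(s + 1/2) is taken
    out. *)
Lemma corr_rest_kernel_bound (h : R) n : 0 < h -> h <= 1 -> (0 < n)%N ->
  `|corr_rest n * cubic_kernel (h ^- 2) (lambda2 R n k)| <=
   k.+1%:R ^+ 3 * Cx ^+ 3 * h `^ (s + 1 / 2) *
    ((2 * (Num.sqrt 2 * (`|al| + `|be|)) + 8) * weighted3 n ^+ 2 +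
     32 * (Num.sqrt 2 * (`|al| + `|be|)) * (h / (1 + n%:R * h) ^+ 2)).
Proof.
move=> h0 h1 n0; have n0' : 0 < n%:R :> R by rewrite ltr0n.
have w0 : 0 < h ^- 2 by rewrite invr_gt0 exprn_gt0.
have Fb := cubic_kernel_bound w0 (lambda2_scale_ge1 k) (sqr_ge0 _) (lambda2_bound k n0).
have rb := corr_rest_bound n0.
have cw := cross_weight s0 s2 h0 n0 erefl.
have sw := square_weight s0 s2 h0 h1 n0 erefl.
rewrite -/Cx -!exprM /= in Fb.
set Q := Num.sqrt 2 * _ in rb *.
have Q0 : 0 <= Q by rewrite mulr_ge0 ?sqrtr_ge0 // addr_ge0.
have T0 := weighted3_ge0 n.
rewrite normrM; apply: le_trans (ler_pM (normr_ge0 _) (normr_ge0 _) rb Fb) _.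
set nu := n%:R `^ _ in cw sw *; set dd := _ + _ in cw sw *.
have dd0 : 0 < dd.
  by rewrite /dd ltr_wpDr ?exprn_gt0 // sqr_ge0.
move: T0; move: (weighted3 n) => T T0.
have -> : k.+1%:R ^+ 3 * (2 * Q * (T * (nu / n%:R ^+ 2)) + T ^+ 2 * nu ^+ 2) *
   (Cx ^+ 3 * (n%:R ^+ 6 / dd)) =
   k.+1%:R ^+ 3 * Cx ^+ 3 *
   (2 * Q * (T * (nu * (n%:R ^+ 4 / dd))) + T ^+ 2 * (nu ^+ 2 * (n%:R ^+ 6 / dd))).
  move: n0' dd0; move: (n%:R : R) (k.+1%:R : R) dd Cx nu {rb Fb cw sw}.
  by move=> x y d C v x0 d0; field; rewrite !gt_eqF.
rewrite -[leRHS]mulrA; apply: ler_wpM2l.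
  apply: mulr_ge0; first exact: exprn_ge0.
  by apply: exprn_ge0; apply: le_trans (lambda2_scale_ge1 k).
have hs : h `^ (s + 1) = h `^ (s + 1 / 2) * h `^ (1 / 2).
  by rewrite -powRD ?(gt_eqF h0) ?implybT //; congr (_ `^ _); field.
have hh : (h `^ (1 / 2)) ^+ 2 = h.
  by rewrite -powR_mulrn ?powR_ge0 // -powRrM mul1r mulVf // powRr1 // ltW.
rewrite hs in cw.
have H0 : 0 < h `^ (s + 1 / 2) by exact: powR_gt0.
have y0 : 0 < 1 + n%:R * h by rewrite ltr_wpDr // mulr_ge0 // ltW.
set y := 1 + _ in cw y0 *.
set H := h `^ (s + 1 / 2) in cw sw H0 *; set g := h `^ (1 / 2) in cw hh.
have gy : T * (8 * g / y) <= T ^+ 2 + 16 * (h / y ^+ 2).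
  have -> : h / y ^+ 2 = (g / y) ^+ 2 by rewrite expr_div_n hh.
  rewrite -mulrA; move: (g / y) => z.
  by have := sqr_ge0 (T - 4 * z); nra.
apply: le_trans (_ : 2 * Q * (H * (T ^+ 2 + 16 * (h / y ^+ 2))) + T ^+ 2 * (8 * H) <= _).
  apply: lerD; last by apply: ler_wpM2l => //; exact: sqr_ge0.
  apply: ler_wpM2l; first exact: mulr_ge0.
  apply: le_trans (ler_wpM2l T0 cw) _.
  have -> : T * (8 * (H * g) / y) = H * (T * (8 * g / y)) by ring.
  by rewrite ler_pM2l.
by rewrite le_eqVlt; apply/orP; left; apply/eqP; ring.
Qed.

Lemma corr_rest_sum : exists2 M, 0 <= M & forall h, 0 < h -> h <= 1 ->
  exists2 S, series (fun i =>
      corr_rest i.+1 * cubic_kernel (h ^- 2) (lambda2 R i.+1 k)) @ \oo --> S &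
    `|S| <= M * h `^ (s + 1 / 2).
Proof.
have [M bM] := bounded_weighted3.
have M0 : 0 <= M by have := bM 0%N; rewrite /series /= big_geq.
pose Q := Num.sqrt 2 * (`|al| + `|be|).
have Q0 : 0 <= Q by rewrite mulr_ge0 ?sqrtr_ge0 // addr_ge0.
pose C := k.+1%:R ^+ 3 * Cx ^+ 3.
have C0 : 0 <= C.
  apply: mulr_ge0; first exact: exprn_ge0.
  by apply: exprn_ge0; apply: le_trans (lambda2_scale_ge1 k).
exists (C * ((2 * Q + 8) * M + 32 * Q)).
  by apply: mulr_ge0 => //; apply: addr_ge0; apply: mulr_ge0 => //; lra.
move=> h h0 h1.
apply: (dominated_series (fun i => corr_rest_kernel_bound h0 h1 (ltn0Sn i))) => N.
rewrite /series /= -mulr_sumr big_split /= -2!mulr_sumr -/C -/Q.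
rewrite [leRHS]mulrAC; apply: ler_wpM2l.
  by apply: mulr_ge0 => //; exact: powR_ge0.
apply: lerD; first by apply: ler_wpM2l; [lra|exact: bM].
rewrite -[leRHS]mulr1; apply: ler_wpM2l; first by lra.
by apply: sum_inv_sqr_step_le; exact: ltW.
Qed.

End RestBounds.
End SquareSummablePart.

(** * Expansion of the kernel series *)

Section KernelExpansion.
Context {R : realType}.

(** Summed over n, this is of order h^3. *)
Lemma inv_pow4_weight (h : R) (n : nat) : 0 < h -> (0 < n)%N ->
  (n%:R ^+ 4 + (h ^- 2) ^+ 2)^-1 <= 4 * h ^+ 3 * (h / (1 + n%:R * h) ^+ 2).
Proof.
move=> h0 n0; have n0' : 0 < n%:R :> R by rewrite ltr0n.
set x : R := n%:R in n0' *.
have y0 : 0 < x * h by exact: mulr_gt0.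
have -> : x ^+ 4 + (h ^- 2) ^+ 2 = (1 + (x * h) ^+ 4) / h ^+ 4.
  by move: n0'; move: x {y0} => x x0; field; rewrite gt_eqF.
have -> : 4 * h ^+ 3 * (h / (1 + x * h) ^+ 2) = h ^+ 4 * (4 / (1 + x * h) ^+ 2).
  by move: y0; move: (x * h) => y y0; field; rewrite gt_eqF //; lra.
move: y0; move: (x * h) => y y0.
rewrite invf_div; apply: ler_wpM2l; first by rewrite exprn_ge0 // ltW.
have d4 : 0 < 1 + y ^+ 4 by rewrite ltr_wpDr // exprn_ge0 // ltW.
have d2 : 0 < (1 + y) ^+ 2 by rewrite exprn_gt0 //; lra.
rewrite ler_pdivlMr // mulrC ler_pdivrMr //.
have -> : y ^+ 4 = y ^+ 2 ^+ 2 by rewrite -exprM.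
by have := sqr_ge0 (y - 1); have := sqr_ge0 (y ^+ 2 - 1); nra.
Qed.

Section Affine.
Context (k : nat) (al be : R).
Context (k0 : (0 < k)%N).
Let P := over_index (affine_coef al be).
Let Cx : R := pi ^+ 2 * (1 + k%:R ^+ 2).

(** Two errors, each bounded termwise by a multiple of 1 / (n^4 + h^-4): the n^-6
    remainder of the coefficients, and the change from x_n to lambda_n in the
    kernel, a bounded displacement that is multiplied by coefficients of size
    n^-4. *)
Lemma affine_error_sum : exists2 M, 0 <= M & forall h : R, 0 < h ->
  exists2 S, series (fun i =>
      corr k P P i.+1 * cubic_kernel (h ^- 2) (lambda2 R i.+1 k)
      - corr_main k al be i.+1 * cubic_kernel (h ^- 2) (lambda R i.+1)) @ \oo --> S &
    `|S| <= M * h ^+ 3.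
Proof.
have Cx1 : 1 <= Cx by exact: lambda2_scale_ge1.
have Cx0 : 0 <= Cx by apply: le_trans Cx1.
have [C C0 rC] := corr_affine_rest al be k0.
pose A : R := 4 / pi ^+ 2 * (`|al| + `|be|) ^+ 2.
have A0 : 0 <= A by rewrite mulr_ge0 ?sqr_ge0 // divr_ge0 // sqr_ge0.
pose B := C * Cx ^+ 3 + A * (4 * (lambda R k / 2) * Cx ^+ 2).
have lk0 : 0 <= lambda R k / 2 by rewrite divr_ge0 // sqr_ge0.
have B0 : 0 <= B.
  apply: addr_ge0; apply: mulr_ge0 => //; first exact: exprn_ge0.
  by apply: mulr_ge0; [exact: mulr_ge0|exact: exprn_ge0].
exists (4 * B); first exact: mulr_ge0.
move=> h h0.
have w0 : 0 < h ^- 2 by rewrite invr_gt0 exprn_gt0.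
have bnd i : `|corr k P P i.+1 * cubic_kernel (h ^- 2) (lambda2 R i.+1 k)
      - corr_main k al be i.+1 * cubic_kernel (h ^- 2) (lambda R i.+1)| <=
   4 * B * h ^+ 3 * (h / (1 + i.+1%:R * h) ^+ 2).
  set n := i.+1; have n0 : (0 < n)%N by [].
  have n0' : 0 < n%:R :> R by rewrite ltr0n.
  have Fb := cubic_kernel_bound w0 Cx1 (sqr_ge0 _) (lambda2_bound k n0).
  have Fl := cubic_kernel_lip w0 Cx1 (sqr_ge0 _) (lambda2_bound k n0) (@lambda_bound R k n n0).
  have rn := rC n n0; have en := corr_main_bound k al be n.
  rewrite -/P -/A in rn en.
  have W := inv_pow4_weight h0 n0.
  have xl : `|lambda2 R n k - lambda R n| = lambda R k / 2.
    by rewrite /lambda2 addrAC subrr add0r normrN ger0_norm.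
  rewrite xl -!exprM /= in Fb Fl.
  rewrite (_ : corr k P P n * _ - _ =
    (corr k P P n - corr_main k al be n) * cubic_kernel (h ^- 2) (lambda2 R n k) +
    corr_main k al be n *
      (cubic_kernel (h ^- 2) (lambda2 R n k) - cubic_kernel (h ^- 2) (lambda R n)));
    last by ring.
  apply: le_trans (ler_normD _ _) _.
  rewrite (normrM (_ - _)) (normrM (corr_main _ _ _ _)).
  apply: le_trans (lerD (ler_pM (normr_ge0 _) (normr_ge0 _) rn Fb)
                        (ler_pM (normr_ge0 _) (normr_ge0 _) en Fl)) _.
  have dd0 : 0 < n%:R ^+ 4 + (h ^- 2) ^+ 2.
    by rewrite ltr_wpDr ?exprn_gt0 // sqr_ge0.
  set dd := _ + _ in W dd0 *.
  have -> : C / n%:R ^+ 6 * (Cx ^+ 3 * (n%:R ^+ 6 / dd)) +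
    A / n%:R ^+ 4 * (4 * (lambda R k / 2) * Cx ^+ 2 * (n%:R ^+ 4 / dd)) = B / dd.
    rewrite /B; move: n0' dd0; clear; move: (n%:R : R) dd Cx A (lambda R k).
    by move=> x d c a l x0 d0; field; rewrite !gt_eqF.
  rewrite (_ : 4 * B * _ * _ = B * (4 * h ^+ 3 * (h / (1 + n%:R * h) ^+ 2))); last by ring.
  exact: ler_wpM2l.
apply: (dominated_series bnd) => N.
rewrite /series /= -mulr_sumr -[leRHS]mulr1; apply: ler_wpM2l.
  by apply: mulr_ge0; [exact: mulr_ge0|rewrite exprn_ge0 // ltW].
by apply: sum_inv_sqr_step_le; exact: ltW.
Qed.

(** With y = n pi h, the n-th term is 4 pi^2 h^2 (A - (-1)^n B) y^2 / (1 + y^4). *)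
Lemma affine_main_sum : exists2 M, 0 <= M & forall h : R, 0 < h -> h <= 1 ->
  exists2 S, series (fun i =>
     corr_main k al be i.+1 * cubic_kernel (h ^- 2) (lambda R i.+1)) @ \oo --> S &
    `|S - Num.sqrt 2 * pi ^+ 2 * (al ^+ 2 + (-1) ^+ k * be ^+ 2) * h| <= M * h ^+ 3.
Proof.
have p0 : 0 < pi :> R := pi_gt0 R.
pose A := al ^+ 2 + (-1) ^+ k * be ^+ 2.
pose B := al * be * (1 + (-1) ^+ k).
pose M : R := 4 * pi * (24 * pi ^+ 2 * (`|A| * (pi + 1) + `|B| * (9 * pi + 5))).
have M0 : 0 <= M.
  apply: mulr_ge0; first by apply: mulr_ge0 => //; exact: ltW.
  apply: mulr_ge0; first by apply: mulr_ge0 => //; exact: sqr_ge0.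
  by apply: addr_ge0; apply: mulr_ge0 => //; lra.
exists M => // h h0 h1.
have H0 : 0 < pi * h by exact: mulr_gt0.
have [T1 cT1 T1_le] := sum_quartic H0.
have [T2 cT2 T2_le] := sum_alt_quartic H0.
exists (4 * pi ^+ 2 * h ^+ 2 * (A * T1 - B * T2)).
  apply: (@eq_cvg_series R _ (fun i => 4 * pi ^+ 2 * h ^+ 2 *
     (A * quartic (i.+1%:R * (pi * h)) - B * ((-1) ^+ i.+1 * quartic (i.+1%:R * (pi * h)))))).
    move=> i; rewrite /corr_main /cubic_kernel /quartic /lambda -/A -/B.
    have n0 : 0 < i.+1%:R :> R by rewrite ltr0n.
    move: n0 ((-1) ^+ _); move: (i.+1%:R : R) => x x0 e.
    have d1 : 0 < 1 + (x * (pi * h)) ^+ 4.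
      by rewrite ltr_wpDr // exprn_ge0 // mulr_ge0 ?ltW.
    have -> : (x * pi) ^+ 2 ^+ 3 / ((x * pi) ^+ 2 ^+ 2 + (h ^- 2) ^+ 2) =
      (x * pi) ^+ 6 * h ^+ 4 / (1 + (x * (pi * h)) ^+ 4).
      rewrite (_ : (x * pi) ^+ 2 ^+ 2 + (h ^- 2) ^+ 2 = (1 + (x * (pi * h)) ^+ 4) / h ^+ 4).
        by rewrite invf_div -exprM -mulrA.
      move: (pi : R) => p.
      by field; rewrite gt_eqF.
    move: d1 x0 p0; set d := 1 + _; move: d (pi : R) => d p d0 x0 p0.
    by field; rewrite !gt_eqF.
  by apply: cvg_seriesZ; apply: cvg_seriesB; exact: cvg_seriesZ.
set r := Num.sqrt 2 in T1_le *.
have r0 : 0 < r by rewrite sqrtr_gt0.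
have r2 : r ^+ 2 = 2 by rewrite sqr_sqrtr.
have -> : 4 * pi ^+ 2 * h ^+ 2 * (A * T1 - B * T2) - r * pi ^+ 2 * A * h =
  4 * pi * h * (A * (pi * h * T1 - pi / (2 * r)) - B * (pi * h * T2)).
  have -> : pi / (2 * r) = r * pi / 4.
    rewrite (_ : 2 * r = 4 / r) ?invf_div; first by ring.
    by apply: (mulIf (lt0r_neq0 r0)); rewrite mulfVK ?gt_eqF // -mulrA -expr2 r2; ring.
  by field.
rewrite normrM ger0_norm; last first.
  by apply: mulr_ge0; [apply: mulr_ge0 => //|]; exact: ltW.
have -> : M * h ^+ 3 = 4 * pi * h * (24 * (pi * h) ^+ 2 *
   (`|A| * (pi + 1) + `|B| * (9 * pi + 5))).
  by rewrite /M; ring.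
apply: ler_wpM2l.
  by apply: mulr_ge0; [apply: mulr_ge0 => //|]; exact: ltW.
apply: le_trans (ler_normB _ _) _; rewrite 2!normrM mulrDr.
have php : pi * h <= pi by rewrite ler_piMr // ltW.
have H2 : 0 <= 24 * (pi * h) ^+ 2 by apply: mulr_ge0 => //; exact: sqr_ge0.
apply: lerD.
  rewrite [leRHS]mulrCA; apply: ler_wpM2l => //; apply: le_trans T1_le _.
  by apply: ler_wpM2l => //; lra.
rewrite [leRHS]mulrCA; apply: ler_wpM2l => //; apply: le_trans T2_le _.
by apply: ler_wpM2l => //; lra.
Qed.

End Affine.

(** The sum S2 of the terms involving c is kept apart: its size is not the same
    when c vanishes and in general. *)
Lemma kernel_series_expansion (k : nat) (al be : R) (c u : nat -> R) (S1 : R) :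
  (0 < k)%N ->
  (forall n, (0 < n)%N -> u n = affine_coef al be n + c n) ->
  series (fun i => corr k (over_index u) (over_index u) i.+1 * lambda2 R i.+1 k)
    @ \oo --> S1 ->
  exists2 M, 0 <= M & forall h S2 : R, 0 < h -> h <= 1 ->
    series (fun i => corr_rest k al be c i.+1 *
       cubic_kernel (h ^- 2) (lambda2 R i.+1 k)) @ \oo --> S2 ->
  exists2 v, series (fun i => corr k (over_index u) (over_index u) i.+1 *
       (lambda2 R i.+1 k / (lambda2 R i.+1 k ^+ 2 + (h ^- 2) ^+ 2))) @ \oo --> v &
    `|v - h ^+ 4 * (S1 - Num.sqrt 2 * pi ^+ 2 * (al ^+ 2 + (-1) ^+ k * be ^+ 2) * h)
      + h ^+ 4 * S2| <= M * h ^+ 7.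
Proof.
move=> k0 uE cS1.
have [M1 M10 err] := affine_error_sum al be k0.
have [M2 M20 main] := affine_main_sum k al be.
exists (M1 + M2); first exact: addr_ge0.
move=> h S2 h0 h1 cS2.
have [E1 cE1 E1_le] := err h h0.
have [E2 cE2 E2_le] := main h h0 h1.
have w0 : 0 < h ^- 2 by rewrite invr_gt0 exprn_gt0.
have pE n : over_index u n = over_index (affine_coef al be) n + over_index c n.
  case: n => [|n]; first by rewrite !over_index0 addr0.
  by rewrite /over_index uE // mulrDl.
exists (h ^+ 4 * (S1 - E1 - E2 - S2)).
  apply: (@eq_cvg_series R _ (fun i => h ^+ 4 *
    (corr k (over_index u) (over_index u) i.+1 * lambda2 R i.+1 k
     - (corr k (over_index (affine_coef al be)) (over_index (affine_coef al be)) i.+1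
          * cubic_kernel (h ^- 2) (lambda2 R i.+1 k)
        - corr_main k al be i.+1 * cubic_kernel (h ^- 2) (lambda R i.+1))
     - corr_main k al be i.+1 * cubic_kernel (h ^- 2) (lambda R i.+1)
     - corr_rest k al be c i.+1 * cubic_kernel (h ^- 2) (lambda2 R i.+1 k)))).
    move=> i; rewrite kernelE //.
    have -> : (h ^- 2 ^+ 2)^-1 = h ^+ 4 by rewrite exprVn invrK -exprM.
    have -> : corr k (over_index u) (over_index u) i.+1 =
      corr k (over_index (affine_coef al be)) (over_index (affine_coef al be)) i.+1
      + corr_rest k al be c i.+1.
      by rewrite /corr_rest /corr !pE; ring.
    by ring.
  apply: cvg_seriesZ; apply: cvg_seriesB => //; apply: cvg_seriesB => //.
  exact: cvg_seriesB.
set L := Num.sqrt 2 * _ * _ * h in E2_le *.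
have -> : h ^+ 4 * (S1 - E1 - E2 - S2) - h ^+ 4 * (S1 - L) + h ^+ 4 * S2 =
  - (h ^+ 4 * (E1 + (E2 - L))) by ring.
rewrite normrN normrM ger0_norm; last by rewrite exprn_ge0 // ltW.
have -> : (M1 + M2) * h ^+ 7 = h ^+ 4 * (M1 * h ^+ 3 + M2 * h ^+ 3) by ring.
apply: ler_wpM2l; first by rewrite exprn_ge0 // ltW.
by apply: le_trans (ler_normD _ _) _; exact: lerD.
Qed.

End KernelExpansion.

(** * The constant term as a sum of products of coefficients *)

Section Moments.
Context {R : realType}.
Implicit Types f g u : nat -> R.

Definition finite_corr (k : nat) f g : R :=
  \sum_(0 <= i < k.-1) f i.+1 * g (k - i.+1)%N.

Definition shift_corr (k : nat) f g (i : nat) : R := f i.+1 * g (i.+1 + k)%N.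

(** The value at n - k of the odd extension of g, provided that g vanishes at
    0. *)
Definition signed_dist (k : nat) g (n : nat) : R :=
  if (k <= n)%N then g (n - k)%N else - g (k - n)%N.

Lemma shift_corr_cvg k f g :
  bounded_sums (fun i => f i.+1 ^+ 2) -> bounded_sums (fun i => g i.+1 ^+ 2) ->
  exists v : R, series (shift_corr k f g) @ \oo --> v.
Proof.
move=> bf bg.
have bg' : bounded_sums (fun i => g (i + k).+1 ^+ 2).
  by apply: (@bounded_sums_shift R k (fun i => g i.+1 ^+ 2)) => // i; exact: sqr_ge0.
have [M bM] := bounded_sumsD bf bg'.
suff [v cv _] : exists2 v, series (shift_corr k f g) @ \oo --> v & `|v| <= M by exists v.
apply: dominated_series bM => i /=; rewrite /shift_corr addSn normrM.
rewrite -(real_normK (num_real (f _))) -(real_normK (num_real (g _))).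
move: `|f _| `|g _| => x y.
by have := sqr_ge0 (x - y); nra.
Qed.

Lemma finite_corr_sym k f g : finite_corr k f g = finite_corr k g f.
Proof.
rewrite /finite_corr; case: k => [|k] /=; first by rewrite !big_geq.
rewrite big_nat_rev /= add0n; apply: eq_big_nat => i /andP[_ ik].
rewrite mulrC; congr (g _ * f _); lia.
Qed.

Lemma signed_corr_cvg k f g (v v' : R) : (0 < k)%N -> g 0%N = 0 ->
  series (shift_corr k f g) @ \oo --> v ->
  series (shift_corr k g f) @ \oo --> v' ->
  series (fun i => f i.+1 * (g (i.+1 + k)%N + signed_dist k g i.+1)) @ \oo -->
    v + v' - finite_corr k f g.
Proof.
case: k => // k _ g0 cv cv'.
set K := k.+1 in cv cv' *.
apply: (@eq_cvg_series R _ (fun i => shift_corr K f g i + f i.+1 * signed_dist K g i.+1)).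
  by move=> i; rewrite /shift_corr mulrDr.
rewrite -addrA; apply: cvg_seriesD => //.
have -> : v' - finite_corr K f g =
   \sum_(0 <= i < K) f i.+1 * signed_dist K g i.+1 + v'.
  rewrite addrC; congr (_ + _).
  rewrite /K big_nat_recr //= {2}/signed_dist leqnn subnn g0 mulr0 addr0.
  rewrite /finite_corr /= -sumrN; apply: eq_big_nat => i /andP[_ ik].
  by rewrite /signed_dist leqNgt ltnS ik /= mulrN.
apply: (cvg_series_shift (u := fun i => f i.+1 * signed_dist K g i.+1)).
apply: eq_cvg_series cv' => i.
by rewrite /shift_corr /signed_dist -addSn leq_addl addnK mulrC.
Qed.

(** The terms with |n - k| and n > k are shifted by k, so that they pair with those
    with n + k: as lambda2 n k + lambda2 (n + k) k = 2 pi^2 n (n + k), the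
    denominators cancel. The terms with n < k pair under n |-> k - n, where
    lambda2 n k + lambda2 (k - n) k = - 2 pi^2 n (k - n). *)
Lemma lambda_corr_cvg k u (V : R) : (0 < k)%N ->
  bounded_sums (fun i => u i.+1 ^+ 2) ->
  series (shift_corr k u u) @ \oo --> V ->
  series (fun i => corr k (over_index u) (over_index u) i.+1 * lambda2 R i.+1 k)
    @ \oo --> 2 * pi ^+ 2 * V - pi ^+ 2 * finite_corr k u u.
Proof.
move=> k0 bu cV.
set p := over_index u.
pose g i := p i.+1 * p (i.+1 + k)%N * lambda2 R i.+1 k.
pose f i := p i.+1 * p `|i.+1%:Z - k%:Z|%N * lambda2 R i.+1 k.
have pu n : (0 < n)%N -> p n = u n / n%:R by [].
have bu' : bounded_sums (fun i => u (i + k).+1 ^+ 2).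
  by apply: (@bounded_sums_shift R k (fun i => u i.+1 ^+ 2)) => // i; exact: sqr_ge0.
pose C : R := pi ^+ 2 * (1 + k%:R ^+ 2).
have C0 : 0 <= C by apply: le_trans (lambda2_scale_ge1 k).
have [M bM] := bounded_sumsZ C0 (bounded_sumsD bu bu').
have [G cG _] : exists2 l, series g @ \oo --> l & `|l| <= M.
  apply: dominated_series bM => i; rewrite /g !pu // addSn.
  have lb := @lambda2_bound R k i.+1 isT.
  have n0 : 0 < i.+1%:R :> R by rewrite ltr0n.
  have m0 : 0 < (i + k).+1%:R :> R by rewrite ltr0n.
  have nm : i.+1%:R <= (i + k).+1%:R :> R by rewrite ler_nat ltnS leq_addr.
  rewrite -/C in lb; move: n0 m0 nm lb.
  move: (i.+1%:R : R) ((i + k).+1%:R : R) (u i.+1) (u (i + k).+1) (lambda2 _ _ _).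
  move=> n m x y l n0 m0 nm lb.
  have -> : x / n * (y / m) * l = x * y * (l / (n * m)).
    by field; rewrite !gt_eqF.
  rewrite mulrC normrM; apply: ler_pM => //.
    rewrite normrM normfV (gtr0_norm (x := n * m)) ?mulr_gt0 //.
    rewrite ler_pdivrMr ?mulr_gt0 //; apply: le_trans lb _.
    by apply: ler_wpM2l => //; rewrite expr2 ler_pM2l.
  rewrite ler_norml; have := sqr_ge0 (x - y); have := sqr_ge0 (x + y); nra.
have cG' : series (fun i => f (i + k)%N) @ \oo --> 2 * pi ^+ 2 * V - G.
  apply: (@eq_cvg_series R _ (fun i => 2 * pi ^+ 2 * shift_corr k u u i - g i)).
    move=> i; rewrite /f /g /shift_corr.
    have -> : `|(i + k).+1%:Z - k%:Z|%N = i.+1 by lia.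
    rewrite !pu // addSn /lambda2 /lambda.
    have n0 : 0 < i.+1%:R :> R by rewrite ltr0n.
    have m0 : 0 < (i + k).+1%:R :> R by rewrite ltr0n.
    have mE : (i + k).+1%:R = i.+1%:R + k%:R :> R by rewrite -natrD addSn.
    rewrite mE in m0 *; move: n0 m0.
    move: (i.+1%:R : R) (k%:R : R) (u i.+1) (u (i + k).+1) (pi : R).
    by move=> n m x y q n0 m0; field; rewrite !gt_eqF.
  by apply: cvg_seriesB => //; exact: cvg_seriesZ.
have cf := cvg_series_shift (u := f) cG'.
have fin : \sum_(0 <= i < k) f i = - pi ^+ 2 * finite_corr k u u.
  case: k k0 {bu' C C0 bM cV cG cG' cf g} @f => // k _ f.
  rewrite big_nat_recr //= {2}/f.
  have -> : `|k.+1%:Z - k.+1%:Z|%N = 0%N by lia.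
  rewrite [p 0%N]over_index0 mulr0 mul0r addr0.
  rewrite /finite_corr /=.
  apply: (mulfI (_ : (2 : R) != 0)) => //.
  rewrite [LHS]mulr_natl mulr2n.
  rewrite {1}big_nat_rev /= add0n -big_split /= mulrA mulr_sumr.
  apply: eq_big_nat => i /andP[_ ik].
  rewrite /f.
  have -> : (k - i.+1).+1 = (k - i)%N by lia.
  have -> : `|(k - i)%N%:Z - k.+1%:Z|%N = i.+1 by lia.
  have -> : `|i.+1%:Z - k.+1%:Z|%N = (k - i)%N by lia.
  rewrite !pu ?subn_gt0 // subSS /lambda2 /lambda.
  have n0 : 0 < i.+1%:R :> R by rewrite ltr0n.
  have m0 : 0 < (k - i)%:R :> R by rewrite ltr0n subn_gt0.
  have -> : k.+1%:R = i.+1%:R + (k - i)%:R :> R by rewrite -natrD; congr (_%:R); lia.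
  move: n0 m0; move: (i.+1%:R : R) ((k - i)%:R : R) (u i.+1) (u (k - i)%N) (pi : R).
  by move=> n m x y q n0 m0; field; rewrite !gt_eqF.
have -> : 2 * pi ^+ 2 * V - pi ^+ 2 * finite_corr k u u =
   G + (\sum_(0 <= i < k) f i + (2 * pi ^+ 2 * V - G)) by rewrite fin; ring.
apply: (@eq_cvg_series R _ (fun i => g i + f i)).
  by move=> i; rewrite /corr /g /f -/p; ring.
exact: cvg_seriesD.
Qed.

Lemma cvg_series_telescope_shift (a : R^nat) k : a @ \oo --> (0 : R) ->
  series (fun i => a i - a (i + k)%N) @ \oo --> \sum_(0 <= i < k) a i.
Proof.
move=> a0; elim: k => [|k IH].
  rewrite big_geq //; apply: (@eq_cvg_series R _ (fun=> 0)).
    by move=> i; rewrite addn0 subrr.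
  rewrite (_ : series _ = cst 0); first exact: cvg_cst.
  by apply/funext => N; rewrite /series /= big1.
rewrite big_nat_recr //=.
apply: (@eq_cvg_series R _ (fun i => (a i - a (i + k)%N) + (a (i + k)%N - a (i.+1 + k)%N))).
  by move=> i; rewrite addrA subrK addSnnS.
apply: cvg_seriesD => //.
have -> : series (fun i => a (i + k)%N - a (i.+1 + k)%N) = (fun N => a k - a (N + k)%N).
  apply/funext => N; rewrite /series /=; elim: N => [|N IHN].
    by rewrite big_geq // add0n subrr.
  by rewrite big_nat_recr //= IHN; ring.
rewrite -[X in _ --> X]subr0; apply: cvgB; first exact: cvg_cst.
by rewrite (cvg_shiftn k a).
Qed.

(** Partial fractions of 1 / (n (n + k)) make the series telescopic with limit a
    multiple of a sum over 1 <= n <= k, and those of 1 / (n (k - n)) turn half of the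
    finite sum into the same multiple of the sum over 1 <= n < k. Only the term
    n = k survives in the difference. *)
Lemma affine_shift_corr_cvg k (al be : R) : (0 < k)%N ->
  exists2 v : R, series (shift_corr k (affine_coef al be) (affine_coef al be)) @ \oo --> v &
  v - finite_corr k (affine_coef al be) (affine_coef al be) / 2 =
   2 / (k%:R ^+ 2 * pi ^+ 2) * (al - be) * (al - (-1) ^+ k * be).
Proof.
case: k => // k _; set K := k.+1.
have p0 : 0 < pi :> R := pi_gt0 R.
have K0 : 0 < K%:R :> R by rewrite ltr0n.
pose A := al ^+ 2 + (-1) ^+ K * be ^+ 2.
pose B := al * be * (1 + (-1) ^+ K).
(* The alternating part telescopes only for k even, but B = 0 when k is odd. *)
have BK : B * (-1) ^+ K = B.
  rewrite /B -mulrA mulrDl mul1r -expr2 exprAC sqrrN !expr1n addrC //.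
pose a i : R := (A - (-1) ^+ i.+1 * B) / i.+1%:R.
have sq n : ((-1) ^+ n) ^+ 2 = 1 :> R by rewrite exprAC sqrrN !expr1n.
have s2 : Num.sqrt 2 ^+ 2 = 2 :> R by rewrite sqr_sqrtr.
have prodE n : (al - (-1) ^+ n * be) * (al - (-1) ^+ n * (-1) ^+ K * be) =
    A - (-1) ^+ n * B.
  transitivity (al ^+ 2 + ((-1) ^+ n) ^+ 2 * (-1) ^+ K * be ^+ 2
       - (-1) ^+ n * (al * be * (1 + (-1) ^+ K))); first by ring.
  by rewrite sq mul1r.
have a0 : a @ \oo --> (0 : R).
  have inv0 := @cvg_harmonic R.
  apply: (@squeeze_cvgr _ _ _ _ (fun n => - (`|A| + `|B|) * harmonic n)
     (fun n => (`|A| + `|B|) * harmonic n)).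
  - apply: nearW => n; rewrite mulNr -ler_norml /a normrM normfV normr_nat.
    rewrite /harmonic ler_wpM2r ?invr_ge0 //.
    apply: le_trans (ler_normB _ _) _.
    by rewrite normrM normrX normrN1 expr1n mul1r.
  - by rewrite -[X in _ --> X](mulr0 (- (`|A| + `|B|))); exact: cvgMl_tmp.
  - by rewrite -[X in _ --> X](mulr0 (`|A| + `|B|)); exact: cvgMl_tmp.
have tele := cvg_series_telescope_shift (k := K) a0.
exists (2 / (K%:R * pi ^+ 2) * \sum_(0 <= i < K) a i).
  apply: (@eq_cvg_series R _ (fun i => 2 / (K%:R * pi ^+ 2) * (a i - a (i + K)%N))).
    move=> i; rewrite /shift_corr /affine_coef /a -addSn exprD natrD.
    have -> : A - (-1) ^+ i.+1 * (-1) ^+ K * B = A - (-1) ^+ i.+1 * B.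
      by rewrite -mulrA (mulrC _ B) BK.
    rewrite -prodE -[in RHS]s2.
    have n0 : 0 < i.+1%:R :> R by rewrite ltr0n.
    move: n0 K0 p0; move: (al - _) (al - _) (i.+1%:R : R) (K%:R : R) (pi : R).
    move: (Num.sqrt 2) => r x y n m q n0 m0 q0.
    by field; rewrite !gt_eqF // addr_gt0.
  exact: cvg_seriesZ.
have finE : finite_corr K (affine_coef al be) (affine_coef al be) =
    2 / (K%:R * pi ^+ 2) * (2 * \sum_(0 <= i < k) a i).
  rewrite /finite_corr /= (_ : 2 * \sum_(0 <= i < k) a i =
    \sum_(0 <= i < k) a i + \sum_(0 <= i < k) a i); last by ring.
  rewrite [X in _ * (X + _)]big_nat_rev /= add0n -big_split /=.
  rewrite mulr_sumr; apply: eq_big_nat => i /andP[_ ik].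
  rewrite subSS /affine_coef /a.
  have -> : (k - i.+1).+1 = (k - i)%N by lia.
  have sgE : (-1) ^+ (k - i) = (-1) ^+ i.+1 * (-1) ^+ K :> R.
    have -> : K = (k - i + i.+1)%N by rewrite /K; lia.
    by rewrite exprD mulrCA -expr2 sq mulr1.
  rewrite sgE.
  have -> : A - (-1) ^+ i.+1 * (-1) ^+ K * B = A - (-1) ^+ i.+1 * B.
    by rewrite -mulrA (mulrC _ B) BK.
  rewrite -prodE -[in RHS]s2.
  have n0 : 0 < i.+1%:R :> R by rewrite ltr0n.
  have m0 : 0 < (k - i)%:R :> R by rewrite ltr0n subn_gt0.
  have -> : K%:R = i.+1%:R + (k - i)%:R :> R.
    by rewrite -natrD; congr (_%:R); rewrite /K; lia.
  move: n0 m0 p0; move: (al - _) (al - _) (i.+1%:R : R) ((k - i)%:R : R) (pi : R).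
  move: (Num.sqrt 2) => r x y n m q n0 m0 q0.
  by field; rewrite !gt_eqF // addr_gt0.
rewrite finE /K big_nat_recr //= -/K.
set S := \sum_(_ <= _ < _) _.
have -> : a k = ((al - be) * (al - (-1) ^+ K * be)) / K%:R.
  rewrite /a -/K; congr (_ / _).
  rewrite [_ * B]mulrC BK /A /B; ring.
move: K0 p0; move: (K%:R : R) (pi : R) ((-1) ^+ K : R) => m q e m0 q0.
by field; rewrite !gt_eqF.
Qed.

End Moments.

(** * Integrals over the unit interval and sine coefficients *)

Section Integrals.
Context {R : realType}.
Implicit Types (f g F : R -> R) (x : R).
Notation mu := (@lebesgue_measure R).
Notation "\int01 f" := (Rintegral mu `[0, 1]%classic f) (at level 10).

Lemma derive_continuous f (df : R -> R) :
  (forall x, is_derive x 1 f (df x)) -> continuous f.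
Proof.
move=> d x; apply/differentiable_continuous/derivable1_diffP.
by have [] := d x.
Qed.

Lemma continuous_integrable01 f : continuous f ->
  mu.-integrable `[0, 1] (EFin \o f).
Proof.
move=> cf; apply: continuous_compact_integrable; first exact: segment_compact.
exact: continuous_subspaceT.
Qed.

Lemma int01D f g : continuous f -> continuous g ->
  \int01 (fun x => f x + g x) = \int01 f + \int01 g.
Proof. by move=> cf cg; apply: RintegralD => //; exact: continuous_integrable01. Qed.

Lemma int01B f g : continuous f -> continuous g ->
  \int01 (fun x => f x - g x) = \int01 f - \int01 g.
Proof. by move=> cf cg; apply: RintegralB => //; exact: continuous_integrable01. Qed.

Lemma int01Z (a : R) f : continuous f ->
  \int01 (fun x => a * f x) = a * \int01 f.
Proof. by move=> cf; apply: RintegralZl => //; exact: continuous_integrable01. Qed.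

Lemma eq_int01 f g : (forall x, 0 <= x <= 1 -> f x = g x) -> \int01 f = \int01 g.
Proof.
by move=> fg; apply: eq_Rintegral => x; rewrite inE /= in_itv /= => /fg.
Qed.

Lemma continuous_mul f g : continuous f -> continuous g ->
  continuous (fun x => f x * g x).
Proof. by move=> cf cg x; apply: cvgM; [exact: cf|exact: cg]. Qed.

Lemma continuous_add f g : continuous f -> continuous g ->
  continuous (fun x => f x + g x).
Proof. by move=> cf cg x; apply: cvgD; [exact: cf|exact: cg]. Qed.

Lemma int01_norm_le f g (M : R) : continuous f -> continuous g ->
  (forall x, 0 <= x <= 1 -> `|f x| <= M * `|g x|) ->
  `|\int01 f| <= M * \int01 (fun x => `|g x|).
Proof.
move=> cf cg fg.
have cng : continuous (fun x => `|g x|) by move=> x; apply: cvg_norm; exact: cg.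
have cnf : continuous (fun x => `|f x|) by move=> x; apply: cvg_norm; exact: cf.
apply: le_trans (le_normr_Rintegral _ (continuous_integrable01 cf)) _ => //.
rewrite -int01Z //; apply: le_Rintegral => //.
- exact: continuous_integrable01.
- by apply: continuous_integrable01; apply: continuous_mul => // x; exact: cvg_cst.
Qed.

Lemma int01_FTC f F : (forall x, is_derive x 1 F (f x)) -> continuous f ->
  \int01 f = F 1 - F 0.
Proof.
move=> dF cf.
have cF : continuous F := derive_continuous dF.
rewrite /Rintegral (@continuous_FTC2 R f F 0 1) //.
- exact: continuous_subspaceT.
- split.
  + by move=> x _; have [] := dF x.
  + by apply: cvg_at_right_filter; exact: cF.
  + by apply: cvg_at_left_filter; exact: cF.
- by move=> x _; rewrite derive1E; have [_ ->] := dF x.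
Qed.

Lemma is_derive_lin (w x : R) : is_derive x 1 (fun y => w * y) w.
Proof.
have h := is_derive_fM (is_derive_cst w x 1) (is_derive_id x 1).
by apply: is_derive_eq h _; rewrite /= mul0r add0r mulr1.
Qed.

Lemma is_derive_sin_lin (w x : R) :
  is_derive x 1 (fun y => sin (w * y)) (cos (w * x) * w).
Proof. exact: (is_derive_comp (f := sin) (g := fun y => w * y) _ (is_derive_lin w x)). Qed.

Lemma is_derive_cos_lin (w x : R) :
  is_derive x 1 (fun y => cos (w * y)) (- sin (w * x) * w).
Proof. exact: (is_derive_comp (f := cos) (g := fun y => w * y) _ (is_derive_lin w x)). Qed.

Lemma continuous_sin_lin (w : R) : continuous (fun x => sin (w * x)).
Proof. exact: (derive_continuous (is_derive_sin_lin w)). Qed.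

Lemma continuous_cos_lin (w : R) : continuous (fun x => cos (w * x)).
Proof. exact: (derive_continuous (is_derive_cos_lin w)). Qed.

Lemma continuous_phi (n : nat) : continuous (@phi R n).
Proof.
apply: continuous_mul; last exact: continuous_sin_lin.
by move=> x; exact: cvg_cst.
Qed.

Lemma sin_natpi (n : nat) : sin (n%:R * pi) = 0 :> R.
Proof.
elim: n => [|n IH]; first by rewrite mul0r sin0.
by rewrite -natr1 mulrDl mul1r sinD sinpi cospi IH mul0r mulr0 addr0.
Qed.

Lemma cos_natpi (n : nat) : cos (n%:R * pi) = (-1) ^+ n :> R.
Proof.
elim: n => [|n IH]; first by rewrite mul0r cos0.
by rewrite -natr1 mulrDl mul1r cosD sinpi cospi IH mulr0 subr0 exprSr.
Qed.

Lemma int01_cos (w : R) : w != 0 -> \int01 (fun x => cos (w * x)) = sin w / w.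
Proof.
move=> w0.
have dF x : is_derive x 1 (fun y => sin (w * y) * w^-1) (cos (w * x)).
  have h := is_derive_fM (is_derive_sin_lin w x) (is_derive_cst w^-1 x 1).
  by apply: is_derive_eq h _; rewrite /= mulr0 addr0 mulfK.
rewrite (int01_FTC dF (@continuous_cos_lin w)).
by rewrite mulr1 mulr0 sin0 mul0r subr0.
Qed.

Lemma int01_one : \int01 (fun=> 1) = 1.
Proof.
rewrite (int01_FTC (is_derive_lin 1)); first by rewrite mulr1 mulr0 subr0.
by move=> x; exact: cvg_cst.
Qed.

Lemma sine_coef_phi (m n : nat) : (0 < m)%N -> (0 < n)%N ->
  sine_coef (@phi R m) n = (m == n)%:R.
Proof.
move=> m0 n0; rewrite /sine_coef /inner.
have p0 : pi != 0 :> R by rewrite gt_eqF // pi_gt0.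
transitivity (\int01 (fun x => cos ((m%:R - n%:R) * pi * x) - cos ((m%:R + n%:R) * pi * x))).
  apply: eq_int01 => x _; rewrite /phi.
  rewrite mulrACA -expr2 sqr_sqrtr // !mulrBl !mulrDl cosB cosD; ring.
rewrite int01B; try exact: continuous_cos_lin.
have sD : sin ((m%:R + n%:R) * pi) = 0 :> R by rewrite -natrD sin_natpi.
rewrite [X in _ - X]int01_cos; last by rewrite mulf_neq0 // -natrD pnatr_eq0; lia.
rewrite sD mul0r subr0.
have [->|mn] := eqVneq m n.
  rewrite subrr mul0r -[RHS]int01_one; apply: eq_int01 => x _.
  by rewrite mul0r cos0.
rewrite int01_cos; last by rewrite mulf_neq0 // subr_eq0 eqr_nat.
by rewrite mulrBl sinB !sin_natpi mul0r mulr0 subr0 mul0r.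
Qed.

Lemma sine_coef0 f : sine_coef f 0%N = 0.
Proof.
rewrite /sine_coef /inner.
transitivity (\int01 (fun=> 0 * 1)).
  by apply: eq_int01 => x _; rewrite /phi !mul0r sin0 !mulr0.
by rewrite int01Z ?mul0r // => x; exact: cvg_cst.
Qed.

Definition chord (al be x : R) : R := (be - al) * x + al.

Lemma is_derive_chord al be x : is_derive x 1 (chord al be) (be - al).
Proof.
have h := is_derive_fD (is_derive_lin (be - al) x) (is_derive_cst al x 1).
by apply: is_derive_eq h _; rewrite addr0.
Qed.

Lemma continuous_chord al be : continuous (chord al be).
Proof. exact: (derive_continuous (is_derive_chord al be)). Qed.

Lemma sine_coef_chord al be n : sine_coef (chord al be) n = affine_coef al be n.
Proof.
case: n => [|n].
  by rewrite sine_coef0 /affine_coef mul0r invr0 mulr0 mul0r.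
rewrite /sine_coef /inner.
pose w : R := n.+1%:R * pi.
have w0 : w != 0 by rewrite mulf_neq0 ?pnatr_eq0 // gt_eqF // pi_gt0.
pose r : R := Num.sqrt 2.
pose F x := r / w * (sin (w * x) * ((be - al) / w) - chord al be x * cos (w * x)).
suff dF x : is_derive x 1 F (chord al be x * phi n.+1 x).
  rewrite (int01_FTC dF); last first.
    apply: continuous_mul; [exact: continuous_chord|exact: continuous_phi].
  rewrite /F /chord !mulr1 !mulr0 sin0 cos0 add0r /w sin_natpi cos_natpi -/w /affine_coef -/r -/w.
  by ring.
have h1 := is_derive_fM (is_derive_sin_lin w x) (is_derive_cst ((be - al) / w) x 1).
have h2 := is_derive_fM (is_derive_chord al be x) (is_derive_cos_lin w x).
have h := is_derive_fM (is_derive_cst (r / w) x 1) (is_derive_fB h1 h2).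
apply: is_derive_eq h _; rewrite /= /phi -/w -/r {h1 h2}.
move: (chord al be x) (cos (w * x)) (sin (w * x)) => a b c.
by clearbody w r; field.
Qed.

Lemma int01_chord_sqr_cos al be k : (0 < k)%N ->
  \int01 (fun x => chord al be x ^+ 2 * cos (k%:R * pi * x)) =
   2 / (k%:R ^+ 2 * pi ^+ 2) * (al - be) * (al - (-1) ^+ k * be).
Proof.
move=> k0.
set w : R := k%:R * pi.
have w0 : w != 0 by rewrite mulf_neq0 ?gt_eqF ?pi_gt0 ?ltr0n.
pose d := be - al.
pose F x := (chord al be x ^+ 2 * sin (w * x)) * w^-1
   + (chord al be x * cos (w * x)) * (2 * d / w ^+ 2)
   - sin (w * x) * (2 * d ^+ 2 / w ^+ 3).
suff dF x : is_derive x 1 F (chord al be x ^+ 2 * cos (w * x)).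
  rewrite (int01_FTC dF); last first.
    apply: continuous_mul; last exact: continuous_cos_lin.
    by move=> x; apply: continuous_mul; exact: continuous_chord.
  rewrite /F /chord !mulr1 !mulr0 sin0 cos0 add0r /w sin_natpi cos_natpi -/w.
  rewrite -exprMn -/w /d; move: ((-1) ^+ k : R) => e.
  by clearbody w; field.
have dc := is_derive_chord al be x.
have h1 := is_derive_fM (is_derive_fM (is_derive_fX 2 dc) (is_derive_sin_lin w x))
  (is_derive_cst w^-1 x 1).
have h2 := is_derive_fM (is_derive_fM dc (is_derive_cos_lin w x))
  (is_derive_cst (2 * d / w ^+ 2) x 1).
have h3 := is_derive_fM (is_derive_sin_lin w x) (is_derive_cst (2 * d ^+ 2 / w ^+ 3) x 1).
have h := is_derive_fB (is_derive_fD h1 h2) h3.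
apply: is_derive_eq h _; rewrite /= -/d {h1 h2 h3 dc}.
move: (chord al be x) (cos (w * x)) (sin (w * x)) => a b c.
by clearbody w d; field.
Qed.

(** For n < k the term of index n - k is the odd reflection, hence
    [signed_dist]. *)
Lemma phi_cos (n k : nat) (x : R) :
  @phi R n x * cos (k%:R * pi * x) =
    (@phi R (n + k)%N x + signed_dist k (fun m => @phi R m x) n) / 2.
Proof.
have -> : signed_dist k (fun m => @phi R m x) n =
    Num.sqrt 2 * sin (n%:R * pi * x - k%:R * pi * x).
  rewrite /signed_dist; case: ifPn => [kn|].
    by rewrite /phi natrB // !mulrBl.
  rewrite -ltnNge => nk; rewrite /phi natrB ?(ltnW nk) //.
  by rewrite -mulrN -sinN !mulrBl opprB.
by rewrite /phi natrD !mulrDl sinD sinB; field.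
Qed.

Lemma sine_coef_cos f n k : continuous f ->
  sine_coef (fun x => f x * cos (k%:R * pi * x)) n =
    (sine_coef f (n + k)%N + signed_dist k (sine_coef f) n) / 2.
Proof.
move=> cf; rewrite /sine_coef /inner.
have cfp m : continuous (fun x => f x * @phi R m x).
  by apply: continuous_mul => //; exact: continuous_phi.
transitivity (\int01 (fun x => 2^-1 * (f x * @phi R (n + k)%N x +
    signed_dist k (fun m => f x * @phi R m x) n))).
  apply: eq_int01 => x _; rewrite -mulrA (mulrC (cos _)) phi_cos /signed_dist.
  by case: ifP => _; ring.
have cs : continuous (fun x => signed_dist k (fun m => f x * @phi R m x) n).
  rewrite /signed_dist; case: (k <= n)%N => //.
  by move=> x; apply: cvgN; exact: cfp.
rewrite int01Z; last exact: continuous_add.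
rewrite int01D // mulrC; congr (_ * _); congr (_ + _).
rewrite /signed_dist; case: (k <= n)%N => //.
rewrite -mulN1r -int01Z //.
by apply: eq_int01 => x _; rewrite mulN1r.
Qed.

End Integrals.

(** * Sine sums and the cosine moment of the square *)

Section SineSum.
Context {R : realType}.
Implicit Types (f g : R -> R) (x : R) (c : nat -> R).
Notation mu := (@lebesgue_measure R).
Notation "\int01 f" := (Rintegral mu `[0, 1]%classic f) (at level 10).

Definition sine_partial c (N : nat) (x : R) : R :=
  series (fun i => c i.+1 * phi i.+1 x) N.

Lemma phi_le n x : `|phi n x| <= Num.sqrt 2.
Proof.
rewrite /phi normrM ger0_norm ?sqrtr_ge0 // ler_piMr ?sqrtr_ge0 //.
exact: sin_max.
Qed.

(** The tails of the series of |c_i| bound the error, up to the factor sqrt 2. *)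
Lemma sine_sum_uniform c : bounded_sums (fun i => `|c i.+1|) ->
  exists2 e : R^nat, e @ \oo --> (0 : R) &
    forall N x, `|sine_sum c x - sine_partial c N x| <= e N.
Proof.
move=> [M bM].
have [A cA _] : exists2 A, series (fun i => `|c i.+1|) @ \oo --> A & `|A| <= M.
  by apply: dominated_series bM => i; rewrite normr_id.
pose S : R^nat := series (fun i => `|c i.+1|).
exists (fun N => Num.sqrt 2 * (A - S N)).
  have -> : (0 : R) = Num.sqrt 2 * (A - A) by rewrite subrr mulr0.
  by apply: cvgMl_tmp; apply: cvgB => //; exact: cvg_cst.
move=> N x.
have bx i : `|c i.+1 * phi i.+1 x| <= Num.sqrt 2 * `|c i.+1|.
  by rewrite normrM mulrC ler_wpM2r // phi_le.
have [l cl _] : exists2 l, series (fun i => c i.+1 * phi i.+1 x) @ \oo --> l &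
    `|l| <= Num.sqrt 2 * M.
  apply: dominated_series bx _ => K.
  by rewrite /series /= -mulr_sumr ler_wpM2l ?sqrtr_ge0 //; exact: bM.
have -> : sine_sum c x = l by exact: cvg_lim cl.
have cn : `|series (fun i => c i.+1 * phi i.+1 x) n - sine_partial c N x|
   @[n --> \oo] --> `|l - sine_partial c N x|.
  by apply: cvg_norm; apply: cvgB => //; exact: cvg_cst.
rewrite -(cvg_lim _ cn) //; apply: limr_le; first by apply/cvg_ex; eexists; exact: cn.
near=> n.
have Nn : (N <= n)%N by near: n; exact: nbhs_infty_ge.
rewrite /sine_partial sub_series_geq //.
apply: le_trans (ler_norm_sum _ _ _) _.
apply: le_trans (ler_sum _ (fun i _ => bx i)) _.
rewrite -mulr_sumr ler_wpM2l ?sqrtr_ge0 //.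
rewrite -sub_series_geq // lerD2r.
exact: (ge0_sum_le_series (fun i => normr_ge0 (c i.+1)) cA).
Unshelve. all: by end_near. Qed.

Lemma continuous_sine_partial c N : continuous (sine_partial c N).
Proof.
elim: N => [|N IH].
  have -> : sine_partial c 0 = cst 0.
    by apply/funext => x; rewrite /sine_partial /series /= big_geq.
  exact: cst_continuous.
have -> : sine_partial c N.+1 = (fun x => sine_partial c N x + c N.+1 * phi N.+1 x).
  by apply/funext => x; rewrite /sine_partial /series /= big_nat_recr.
apply: continuous_add => //; apply: continuous_mul; last exact: continuous_phi.
exact: cst_continuous.
Qed.

Lemma continuous_sine_sum c : bounded_sums (fun i => `|c i.+1|) ->
  continuous (sine_sum c).
Proof.
move=> /sine_sum_uniform[e e0 ce] x; apply/cvgrPdist_le => eps eps0.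
have e3 : 0 < eps / 3 by rewrite divr_gt0.
have [N eN] : exists N, e N <= eps / 3.
  have /cvgrPdist_le/(_ _ e3) [N _ /(_ N (leqnn N))] := e0.
  by rewrite sub0r normrN => h; exists N; apply: le_trans (ler_norm _) h.
have /cvgrPdist_le/(_ _ e3) := @continuous_sine_partial c N x.
apply: filterS => y hy.
have hx := ce N x; have hy' := ce N y.
rewrite (_ : sine_sum c x - sine_sum c y =
  (sine_sum c x - sine_partial c N x) + (sine_partial c N x - sine_partial c N y)
  - (sine_sum c y - sine_partial c N y)); last by ring.
apply: le_trans (ler_normB _ _) _.
apply: le_trans (lerD (ler_normD _ _) (lexx _)) _.
by move: hx hy hy' eN; lra.
Qed.

(** Term by term integration is justified by uniform convergence. *)
Lemma int01_sine_sum c g : bounded_sums (fun i => `|c i.+1|) -> continuous g ->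
  series (fun i => c i.+1 * sine_coef g i.+1) @ \oo -->
    \int01 (fun x => sine_sum c x * g x).
Proof.
move=> bc cg.
have cs := continuous_sine_sum bc.
have [e e0 ce] := sine_sum_uniform bc.
have part N : series (fun i => c i.+1 * sine_coef g i.+1) N =
    \int01 (fun x => sine_partial c N x * g x).
  elim: N => [|N IH].
    rewrite /series /= big_geq //.
    transitivity (\int01 (fun x => 0 * g x)); first by rewrite int01Z // mul0r.
    by apply: eq_int01 => x _; rewrite /sine_partial /series /= big_geq.
  rewrite seriesSr IH.
  transitivity (\int01 (fun x => sine_partial c N x * g x + c N.+1 * (g x * phi N.+1 x))).
    rewrite int01D ?int01Z //.
    - by apply: continuous_mul => //; exact: continuous_phi.
    - by apply: continuous_mul => //; exact: continuous_sine_partial.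
    - apply: continuous_mul; first exact: cst_continuous.
      by apply: continuous_mul => //; exact: continuous_phi.
  apply: eq_int01 => x _.
  by rewrite /sine_partial seriesSr mulrDl; ring.
set G := \int01 (fun x => `|g x|).
have G0 : 0 <= G by apply: Rintegral_ge0.
apply/cvgrPdist_le => eps eps0.
have eG : e n * G @[n --> \oo] --> (0 : R).
  by rewrite -[X in _ --> X](mul0r G); exact: cvgMr_tmp.
have /cvgrPdist_le/(_ _ eps0) := eG.
apply: filterS => N; rewrite sub0r normrN => hN.
rewrite part -int01B.
- apply: le_trans (le_trans (ler_norm _) hN).
  apply: int01_norm_le => //.
  + apply: (@continuous_add R (fun x => sine_sum c x * g x)
      (fun x => - (sine_partial c N x * g x))); first exact: continuous_mul.
    by move=> x; apply: cvgN; apply: continuous_mul => //; exact: continuous_sine_partial.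
  + by move=> x _; rewrite -mulrBl normrM ler_wpM2r.
- exact: continuous_mul.
- by apply: continuous_mul => //; exact: continuous_sine_partial.
Qed.

Lemma sine_coef_sine_sum c n : bounded_sums (fun i => `|c i.+1|) -> (0 < n)%N ->
  sine_coef (sine_sum c) n = c n.
Proof.
case: n => // n bc _.
have h := int01_sine_sum bc (@continuous_phi R n.+1).
suff h' : series (fun j => c j.+1 * sine_coef (@phi R n.+1) j.+1) @ \oo --> c n.+1.
  exact: (cvg_unique _ h h').
rewrite -(cvg_shiftn n.+1).
rewrite (_ : (fun N => _) = cst (c n.+1)); first exact: cvg_cst.
apply/funext => N; rewrite /series /= (bigD1_seq n) ?iota_uniq //=; last first.
  by rewrite mem_index_iota; lia.
rewrite sine_coef_phi // eqxx mulr1 big1 ?addr0 // => i ni.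
by rewrite sine_coef_phi // eqSS eq_sym (negbTE ni) mulr0.
Qed.

Lemma sine_coefD f g n : continuous f -> continuous g ->
  sine_coef (fun x => f x + g x) n = sine_coef f n + sine_coef g n.
Proof.
move=> cf cg; rewrite /sine_coef /inner -int01D.
- by apply: eq_int01 => x _; rewrite mulrDl.
- by apply: continuous_mul => //; exact: continuous_phi.
- by apply: continuous_mul => //; exact: continuous_phi.
Qed.

Lemma sine_coefZ (a : R) f n : continuous f ->
  sine_coef (fun x => a * f x) n = a * sine_coef f n.
Proof.
move=> cf; rewrite /sine_coef /inner -int01Z.
- by apply: eq_int01 => x _; rewrite mulrA.
- by apply: continuous_mul => //; exact: continuous_phi.
Qed.

Lemma affine_coef_sqr_bounded (al be : R) :
  bounded_sums (fun i => affine_coef al be i.+1 ^+ 2).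
Proof.
have [M bM] := @sum_powR_le R 1 ltr01.
pose Q : R := Num.sqrt 2 * (`|al| + `|be|).
apply: (@bounded_sums_le R _ (fun i => Q ^+ 2 * (i.+1%:R `^ (1 + 1))^-1)).
  move=> i; have := affine_over_index_bound al be i.+1.
  rewrite -/Q /over_index normrM normfV normr_nat.
  have n0 : 0 < i.+1%:R :> R by rewrite ltr0n.
  rewrite ler_pdivrMr // expr2 invfM mulrA mulfVK ?gt_eqF // => h.
  rewrite -(_ : (2%:R : R) = 1 + 1) // powR_mulrn // -exprVn -exprMn.
  by rewrite -(real_normK (num_real (affine_coef _ _ _))) lerXn2r ?nnegrE // (le_trans _ h).
apply: bounded_sumsZ; first exact: sqr_ge0.
by exists M.
Qed.

Section SquareMoment.
Context (k : nat) (al be : R) (c : nat -> R).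
Context (k0 : (0 < k)%N).
Context (bc : bounded_sums (fun i => `|c i.+1|)).
Context (bc2 : bounded_sums (fun i => c i.+1 ^+ 2)).

Let m x := chord al be x + sine_sum c x.

Lemma continuous_chord_sine_sum : continuous m.
Proof.
by apply: continuous_add; [exact: continuous_chord|exact: continuous_sine_sum].
Qed.

Lemma sine_coef_chord_sine_sum n : (0 < n)%N ->
  sine_coef m n = affine_coef al be n + c n.
Proof.
move=> n0; rewrite sine_coefD ?sine_coef_chord ?sine_coef_sine_sum //.
- exact: continuous_chord.
- exact: continuous_sine_sum.
Qed.

Lemma sine_coef_sqr_bounded : bounded_sums (fun i => sine_coef m i.+1 ^+ 2).
Proof.
apply: bounded_sums_le (bounded_sumsZ (ler0n _ 2)
  (bounded_sumsD (affine_coef_sqr_bounded al be) bc2)) => i.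
rewrite sine_coef_chord_sine_sum //.
by have := sqr_ge0 (affine_coef al be i.+1 - c i.+1); nra.
Qed.

(** The square splits as (chord)^2 + sine_sum c * (2 chord + sine_sum c). The first
    part is explicit on both sides; in the second the factor [sine_sum c] is
    integrated term by term against the other one, whose coefficients are known,
    and the resulting bilinear sums are those of the sequence of mu. *)
Lemma int01_sqr_cos : exists2 V : R,
  series (shift_corr k (sine_coef m) (sine_coef m)) @ \oo --> V &
  \int01 (fun x => m x ^+ 2 * cos (k%:R * pi * x)) =
    V - finite_corr k (sine_coef m) (sine_coef m) / 2.
Proof.
pose a := affine_coef al be.
pose d := sine_coef (sine_sum c).
have dE n : (0 < n)%N -> d n = c n by move=> n0; exact: sine_coef_sine_sum.
have mE n : (0 < n)%N -> sine_coef m n = a n + d n.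
  by move=> n0; rewrite sine_coef_chord_sine_sum // dE.
have ba : bounded_sums (fun i => a i.+1 ^+ 2) by exact: affine_coef_sqr_bounded.
have bd : bounded_sums (fun i => d i.+1 ^+ 2).
  by apply: bounded_sums_le bc2 => i; rewrite dE.
have [vaa caa vaaE] := affine_shift_corr_cvg al be k0.
have [vad cad] := @shift_corr_cvg R k a d ba bd.
have [vda cda] := @shift_corr_cvg R k d a bd ba.
have [vdd cdd] := @shift_corr_cvg R k d d bd bd.
exists (vaa + vad + vda + vdd).
  apply: (@eq_cvg_series R _ (fun i => shift_corr k a a i + shift_corr k a d i
    + shift_corr k d a i + shift_corr k d d i)).
    by move=> i; rewrite /shift_corr !mE ?addSn //; ring.
  by apply: cvg_seriesD => //; apply: cvg_seriesD => //; exact: cvg_seriesD.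
pose g x := (2 * chord al be x + sine_sum c x) * cos (k%:R * pi * x).
have cc : continuous (chord al be) by exact: continuous_chord.
have cs : continuous (sine_sum c) by exact: continuous_sine_sum.
have c2 : continuous (fun x => 2 * chord al be x).
  by apply: continuous_mul => //; exact: cst_continuous.
have ch : continuous (fun x => 2 * chord al be x + sine_sum c x).
  exact: continuous_add.
have ccos : continuous (fun x => cos (k%:R * pi * x)) by exact: continuous_cos_lin.
have cg : continuous g by exact: continuous_mul.
have csq : continuous (fun x => chord al be x ^+ 2 * cos (k%:R * pi * x)).
  by apply: continuous_mul => // x; apply: continuous_mul.
transitivity (\int01 (fun x => chord al be x ^+ 2 * cos (k%:R * pi * x) + sine_sum c x * g x)).
  by apply: eq_int01 => x _; rewrite /m /g; ring.
rewrite int01D //; last exact: continuous_mul.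
rewrite int01_chord_sqr_cos // -vaaE.
pose w := sine_coef (fun x => 2 * chord al be x + sine_sum c x).
have wE n : w n = 2 * a n + d n.
  by rewrite /w sine_coefD // sine_coefZ // sine_coef_chord.
have w0 : w 0%N = 0 by exact: sine_coef0.
have cdw : series (shift_corr k d w) @ \oo --> 2 * vda + vdd.
  apply: (@eq_cvg_series R _ (fun i => 2 * shift_corr k d a i + shift_corr k d d i)).
    by move=> i; rewrite /shift_corr wE; ring.
  by apply: cvg_seriesD => //; exact: cvg_seriesZ.
have cwd : series (shift_corr k w d) @ \oo --> 2 * vad + vdd.
  apply: (@eq_cvg_series R _ (fun i => 2 * shift_corr k a d i + shift_corr k d d i)).
    by move=> i; rewrite /shift_corr wE; ring.
  by apply: cvg_seriesD => //; exact: cvg_seriesZ.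
have lim1 := cvg_seriesZ (k := 2^-1) (signed_corr_cvg k0 w0 cdw cwd).
have lim2 := int01_sine_sum bc cg.
have -> : \int01 (fun x => sine_sum c x * g x) =
   2^-1 * (2 * vda + vdd + (2 * vad + vdd) - finite_corr k d w).
  apply: (cvg_unique _ lim2) => //.
  apply: eq_cvg_series lim1 => i.
  by rewrite sine_coef_cos // dE // -/w; field.
have fdw : finite_corr k d w = 2 * finite_corr k a d + finite_corr k d d.
  rewrite (finite_corr_sym k a d) /finite_corr mulr_sumr -big_split /=.
  by apply: eq_big_nat => i _; rewrite wE; ring.
have fmm : finite_corr k (sine_coef m) (sine_coef m) =
    finite_corr k a a + 2 * finite_corr k a d + finite_corr k d d.
  transitivity (finite_corr k a a + finite_corr k a d + finite_corr k d a + finite_corr k d d).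
    rewrite /finite_corr -!big_split /=; apply: eq_big_nat => i /andP[_ ik].
    by rewrite !mE ?subn_gt0 //; [ring|lia].
  by rewrite (finite_corr_sym k d a); ring.
by rewrite fdw fmm; field.
Qed.

End SquareMoment.
End SineSum.

(** * From weighted sequences to the asymptotic expansion *)

Section Conclusion.
Context {R : realType}.
Implicit Types (c : nat -> R) (s : R).

Lemma Hspace2_bounded s c : 0 <= s -> Hspace s 2%:E c ->
  bounded_sums (fun i => (i.+1%:R `^ s * c i.+1) ^+ 2).
Proof.
move=> s0; rewrite /Hspace /Hnorm /= Lnorm_counting // => /lty_poweRy.
have h2 : (2^-1 : R) != 0 by [].
move=> /(_ h2) fin.
pose v i : R := (lambda R i.+1 `^ (s / 2) * c i.+1) ^+ 2.
have vE i : (`|(lambda R i.+1 `^ (s / 2) * c i.+1)%:E| `^ 2 = (v i)%:E)%E.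
  by rewrite poweR_EFin /v powR_mulrn // real_normK ?num_real.
have v0 i : 0 <= v i by exact: sqr_ge0.
have {}fin : (\sum_(k <oo) (v k)%:E < +oo)%E.
  by apply: le_lt_trans fin; rewrite le_eqVlt; apply/orP; left; apply/eqP;
     apply: eq_eseriesr => i _; rewrite vE.
have cv := nnseries_is_cvg v0 fin.
apply: (@bounded_sums_le R _ v); last first.
  exists (limn (series v)) => N.
  exact: (ge0_sum_le_series v0 cv).
move=> i; rewrite /v !exprMn; apply: ler_wpM2r; first exact: sqr_ge0.
(* lambda_n ^ (s / 2) = n ^ s * pi ^ s, and pi ^ s >= 1. *)
rewrite ler_sqr ?nnegrE ?powR_ge0 // /lambda.
have -> : ((i.+1%:R * pi) ^+ 2) `^ (s / 2) = i.+1%:R `^ s * pi `^ s :> R.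
  rewrite -powR_mulrn ?mulr_ge0 ?pi_ge0 // -powRrM.
  by rewrite (_ : 2%:R * (s / 2) = s) ?powRM ?pi_ge0 //; field.
rewrite ler_peMr ?powR_ge0 //.
have pi1 : 1 <= pi :> R by have := @pi_ge2 R; lra.
by rewrite -[leLHS](powRr0 pi); exact: ler_powR.
Qed.

(** |c| = n^-s * (n^s |c|) is at most n^-(2s) + (n^s c)^2, and 2 s > 1. *)
Lemma summable_of_weighted s c : 1 / 2 < s ->
  bounded_sums (fun i => (i.+1%:R `^ s * c i.+1) ^+ 2) ->
  bounded_sums (fun i => `|c i.+1|).
Proof.
move=> s1 bc.
have [M bM] := @sum_powR_le R (2 * s - 1) ltac:(lra).
have bn : bounded_sums (fun i => (i.+1%:R `^ (1 + (2 * s - 1)))^-1 : R) by exists M.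
apply: bounded_sums_le (bounded_sumsD bn bc) => i.
have n0 : 0 < i.+1%:R `^ s :> R by rewrite powR_gt0 // ltr0n.
have -> : i.+1%:R `^ (1 + (2 * s - 1)) = (i.+1%:R `^ s) ^+ 2 :> R.
  by rewrite -powR_mulrn ?powR_ge0 // -powRrM; congr (_ `^ _); ring.
move: n0; move: (i.+1%:R `^ s) (c i.+1) => x y x0.
have -> : `|y| = x^-1 * (x * `|y|) by rewrite mulKf ?gt_eqF.
rewrite -exprVn exprMn -(real_normK (num_real y)) -exprMn.
have a0 : 0 <= x^-1 by rewrite invr_ge0 ltW.
have b0 : 0 <= x * `|y| by rewrite mulr_ge0 // ltW.
move: (x^-1) (x * `|y|) a0 b0 => a b a0 b0.
by have := sqr_ge0 (a - b); nra.
Qed.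

Lemma square_summable_of_weighted s c : 0 <= s ->
  bounded_sums (fun i => (i.+1%:R `^ s * c i.+1) ^+ 2) ->
  bounded_sums (fun i => c i.+1 ^+ 2).
Proof.
move=> s0; apply: bounded_sums_le => i.
rewrite exprMn ler_peMl ?sqr_ge0 // exprn_ege1 //.
by rewrite -[leLHS](powRr0 i.+1%:R); apply: ler_powR => //; rewrite ler1n.
Qed.

Lemma affine_coef_Hspace (al be : R) : Hspace 1 +oo%E (affine_coef al be).
Proof.
rewrite /Hspace /Hnorm /= unlock; case: ifPn => // _.
apply: (@le_lt_trans _ _ (Num.sqrt 2 * (`|al| + `|be|))%:E); last exact: ltry.
apply/ess_supP; apply: aeW => i /=.
rewrite lee_fin /lambda.
have p0 : 0 < pi :> R := pi_gt0 R.
have n0 : 0 < i.+1%:R :> R by rewrite ltr0n.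
have -> : ((i.+1%:R * pi) ^+ 2) `^ (1 / 2) = i.+1%:R * pi :> R.
  by rewrite mul1r powR12_sqrt ?sqr_ge0 // sqrtr_sqr ger0_norm // mulr_ge0 // ltW.
rewrite /affine_coef.
have -> : i.+1%:R * pi * (Num.sqrt 2 / (i.+1%:R * pi) * (al - (-1) ^+ i.+1 * be)) =
   Num.sqrt 2 * (al - (-1) ^+ i.+1 * be).
  by rewrite mulrA [X in X * _]mulrC mulfVK // mulf_neq0 ?gt_eqF.
rewrite normrM ger0_norm ?sqrtr_ge0 //; apply: ler_wpM2l; first exact: sqrtr_ge0.
apply: le_trans (ler_normB _ _) _.
by rewrite normrM normrX normrN1 expr1n mul1r.
Qed.

Lemma sine_sum0 c : sine_sum c 0 = 0.
Proof.
rewrite /sine_sum (_ : series _ = cst 0); first exact: lim_cst.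
by apply/funext => N; rewrite /series /= big1 // => i _; rewrite /phi mulr0 sin0 !mulr0.
Qed.

Lemma sine_sum1 c : sine_sum c 1 = 0.
Proof.
rewrite /sine_sum (_ : series _ = cst 0); first exact: lim_cst.
apply/funext => N; rewrite /series /= big1 // => i _.
by rewrite /phi mulr1 sin_natpi !mulr0.
Qed.

Lemma KtermE (f : R -> R) k w n :
  Kterm f k w n = corr k (over_index (sine_coef f)) (over_index (sine_coef f)) n
     * (lambda2 R n k / (lambda2 R n k ^+ 2 + w ^+ 2)).
Proof.
rewrite /Kterm /corr /over_index; congr (_ * _ * _); congr (_ + _).
case: eqP => [->|_]; last by rewrite mulr1.
by rewrite (_ : `|k%:Z - k%:Z|%N = 0%N) ?invr0 ?mulr0 //; lia.
Qed.

Lemma derive1_phi k :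
  derive1 (@phi R k) = (fun x => Num.sqrt 2 * (k%:R * pi) * cos (k%:R * pi * x)).
Proof.
apply/funext => x; rewrite derive1E.
have h := is_derive_fM (is_derive_cst (Num.sqrt 2 : R) x 1) (is_derive_sin_lin (k%:R * pi) x).
have [_ /= ->] := h.
by rewrite mul0r add0r; ring.
Qed.

Lemma powR_half_exp (w a : R) (n : nat) : 0 < w -> a = n%:R / 2 ->
  1 / w `^ a = (w `^ (- (1 / 2))) ^+ n.
Proof.
move=> w0 ->; rewrite -powR_mulrn ?powR_ge0 // -powRrM mul1r -powRN.
by congr (_ `^ _); field.
Qed.

Section Expansion.
Context (k : nat) (al be s : R) (c : nat -> R) (f : R -> R).
Context (k0 : (0 < k)%N).
Context (s12 : 1 / 2 < s <= 2).
Context (bc : bounded_sums (fun i => (i.+1%:R `^ s * c i.+1) ^+ 2)).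
Context (fE : forall x, 0 <= x <= 1 -> f x = chord al be x + sine_sum c x).

Let main w := pi * Num.sqrt 2 * inner (fun x => f x ^+ 2) (derive1 (phi k))
             / (k%:R * w ^+ 2)
           - pi ^+ 2 * Num.sqrt 2 * (al ^+ 2 + (-1) ^+ k * be ^+ 2)
             / w `^ (5 / 2).

Lemma sine_coef_sum n : (0 < n)%N -> sine_coef f n = affine_coef al be n + c n.
Proof.
move: s12 => /andP[s1 _] n0.
rewrite -(sine_coef_chord_sine_sum al be (summable_of_weighted s1 bc) n0).
by apply: eq_int01 => x /fE ->.
Qed.

(** The bridge between the series estimates, written in terms of
    h = w ^ (-1/2), and the function [K]. *)
Lemma K_expansion : exists2 M, 0 <= M & forall w S : R, 1 <= w ->
   series (fun i => corr_rest k al be c i.+1 *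
       cubic_kernel w (lambda2 R i.+1 k)) @ \oo --> S ->
   `|K f k w - main w + S / w ^+ 2| <= M / w `^ (7 / 2).
Proof.
move: s12 => /andP[s1 s2].
have b1 := summable_of_weighted s1 bc.
have b2 := square_summable_of_weighted (ltac:(lra) : 0 <= s) bc.
have fm : sine_coef f = sine_coef (fun x => chord al be x + sine_sum c x).
  by apply/funext => n; apply: eq_int01 => x /fE ->.
have [V cV intV] := int01_sqr_cos al be k0 b1 b2.
have bu := sine_coef_sqr_bounded al be b1 b2.
rewrite -fm in cV intV bu.
have cS1 := lambda_corr_cvg k0 bu cV.
set S1 := _ - _ in cS1.
have [M M0 HM] := kernel_series_expansion k0 sine_coef_sum cS1.
exists M => // w S w1 cS.
have w0 : 0 < w by lra.
pose h := w `^ (- (1 / 2)).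
have h0 : 0 < h by exact: powR_gt0.
have h1 : h <= 1 by rewrite -[leRHS](powRr0 w); apply: ler_powR => //; lra.
have h2 : h ^+ 2 = w^-1.
  by rewrite -(@powR_half_exp w 1 2) ?powRr1 ?mul1r //; [exact: ltW|field].
have hw : h ^- 2 = w by rewrite h2 invrK.
rewrite -{1}hw in cS.
have [v cv v_le] := HM h S h0 h1 cS.
have KE : K f k w = v.
  rewrite /K; apply: cvg_lim => //.
  by apply: eq_cvg_series cv => i; rewrite KtermE hw.
have h4 : h ^+ 4 = w ^- 2 by rewrite -exprVn -h2 -exprM.
have h5 : h ^+ 5 = (w `^ (5 / 2))^-1 by rewrite -(@powR_half_exp w (5 / 2)) ?mul1r.
have h7 : h ^+ 7 = (w `^ (7 / 2))^-1 by rewrite -(@powR_half_exp w (7 / 2)) ?mul1r.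
rewrite h7 in v_le; rewrite KE.
suff -> : v - main w + S / w ^+ 2 =
  v - h ^+ 4 * (S1 - Num.sqrt 2 * pi ^+ 2 * (al ^+ 2 + (-1) ^+ k * be ^+ 2) * h)
      + h ^+ 4 * S by [].
have -> : main w = w ^- 2 * S1
    - pi ^+ 2 * Num.sqrt 2 * (al ^+ 2 + (-1) ^+ k * be ^+ 2) * h ^+ 5.
  rewrite /main h5; congr (_ - _).
  have -> : S1 = 2 * pi ^+ 2 * (V - finite_corr k (sine_coef f) (sine_coef f) / 2).
    by rewrite /S1; field.
  rewrite -intV derive1_phi /inner.
  have cm : continuous (fun x => chord al be x + sine_sum c x).
    exact: continuous_chord_sine_sum.
  rewrite (@eq_int01 R _ (fun x => Num.sqrt 2 * (k%:R * pi) *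
     ((chord al be x + sine_sum c x) ^+ 2 * cos (k%:R * pi * x)))); last first.
    by move=> x /fE ->; ring.
  rewrite int01Z; last first.
    apply: continuous_mul; last exact: continuous_cos_lin.
    by apply: continuous_mul.
  set I := Rintegral _ _ _.
  have sq : Num.sqrt 2 ^+ 2 = 2 :> R by rewrite sqr_sqrtr.
  have kn : k%:R != 0 :> R by rewrite pnatr_eq0 -lt0n.
  rewrite -[X in _ = _ * (X * _ * _)]sq.
  move: kn; move: (k%:R : R) (pi : R) (Num.sqrt 2) => q p r q0.
  by field; rewrite q0 gt_eqF.
by rewrite -h4; ring.
Qed.

End Expansion.
End Conclusion.

Theorem proposition3p2 (R : realType) (ell : R -> R) (k : nat) (s : R)
    (c : nat -> R)
    (hell : affine01 ell) (hk : (1 <= k)%N) (hs : 1 / 2 < s <= 2)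
    (hc : Hspace s 2%:E c) :
  let mu := (fun x : R => ell x + sine_sum c x) in
  let nu := s / 2 - 1 / 4 in
  [/\ Hspace 1 +oo%E (sine_coef ell),
      0 < nu,
      K mu k =
        (fun w : R =>
           pi * Num.sqrt 2 * inner (fun x => mu x ^+ 2) (derive1 (phi k))
             / (k%:R * w ^+ 2)
           - pi ^+ 2 * Num.sqrt 2 * (mu 0 ^+ 2 + (-1) ^+ k * mu 1 ^+ 2)
             / w `^ (5 / 2))
        +O_ (+oo_R) (fun w : R => 1 / w `^ (5 / 2 + nu))
    & (forall x : R, x \in `[0, 1] -> mu x = 1) -> ~~ odd k ->
      K mu k =
        (fun w : R => - (2 * pi ^+ 2 * Num.sqrt 2 / w `^ (5 / 2)))
        +O_ (+oo_R) (fun w : R => 1 / w `^ (7 / 2))].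
Proof.
move=> mu nu.
have /andP[s1 s2] := hs.
have [a [b ellE]] := hell.
pose al := b; pose be := a + b.
have ellc x : 0 <= x <= 1 -> ell x = chord al be x.
  by move=> x01; rewrite ellE ?in_itv // /chord /be /al addrK.
have bc : bounded_sums (fun i => (i.+1%:R `^ s * c i.+1) ^+ 2).
  by apply: Hspace2_bounded hc; lra.
have fE x : 0 <= x <= 1 -> mu x = chord al be x + sine_sum c x.
  by move=> x01; rewrite /mu ellc.
have mu0 : mu 0 = al.
  by rewrite fE ?lexx ?ler01 // sine_sum0 addr0 /chord mulr0 add0r.
have mu1 : mu 1 = be.
  by rewrite fE ?lexx ?ler01 // sine_sum1 addr0 /chord mulr1 subrK.
have [M M0 HM] := K_expansion hk hs bc fE.
  have near1 (P : R -> Prop) : (forall w, 1 <= w -> P w) ->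
    \forall w \near +oo, P w.
  move=> HP; near=> w; apply: HP; near: w; exact: nbhs_pinfty_ge.
split.
- have -> : sine_coef ell = affine_coef al be.
    by apply/funext => n; rewrite -sine_coef_chord; apply: eq_int01 => x /ellc ->.
  exact: affine_coef_Hspace.
- by rewrite /nu; lra.
- rewrite mu0 mu1.
  have [M2 M20 HM2] := @corr_rest_sum R k al be s c s1 s2 bc.
  apply/eqaddOP; apply/bigO_exP; exists (M + M2 + 1); first lra.
  apply: near1 => w w1.
  have w0 : 0 < w by lra.
  pose h := w `^ (- (1 / 2)).
  have h0 : 0 < h by exact: powR_gt0.
  have h1 : h <= 1 by rewrite -[leRHS](powRr0 w); apply: ler_powR => //; lra.
  have h2 : h ^- 2 = w.
    by rewrite -(@powR_half_exp R w 1 2) ?powRr1 ?mul1r ?invrK //; [exact: ltW|field].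
  have [S cS S_le] := HM2 h h0 h1.
  rewrite h2 in cS.
  have main := HM w S w1 cS.
  rewrite !fctE /=.
  set E := _ - _ in main *.
  have -> : E = (E + S / w ^+ 2) - S / w ^+ 2 by rewrite addrK.
  have W0 : 0 < 1 / w `^ (5 / 2 + nu) by rewrite mul1r invr_gt0 powR_gt0.
  rewrite (gtr0_norm W0).
  have i1 : M / w `^ (7 / 2) <= M * (1 / w `^ (5 / 2 + nu)).
    apply: ler_wpM2l => //; rewrite mul1r lef_pV2 ?posrE ?powR_gt0 //.
    by apply: ler_powR => //; rewrite /nu; lra.
  have i2 : `|S / w ^+ 2| <= M2 * (1 / w `^ (5 / 2 + nu)).
    have -> : 1 / w `^ (5 / 2 + nu) = h `^ (s + 1 / 2) / w ^+ 2.
      rewrite mul1r -[w ^+ 2]powR_mulrn ?(ltW w0) // -!powRN /h -powRrM.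
      rewrite -powRD ?(gt_eqF w0) ?implybT //; congr (_ `^ _).
      by rewrite /nu; field.
    rewrite mulrA normrM normfV (gtr0_norm (x := w ^+ 2)) ?exprn_gt0 //.
    by apply: ler_wpM2r => //; rewrite invr_ge0 exprn_ge0 // ltW.
  apply: le_trans (ler_normB _ _) _.
  apply: le_trans (lerD main i2) _.
  apply: le_trans (lerD i1 (lexx _)) _.
  rewrite -mulrDl; apply: ler_wpM2r; first exact: ltW.
  by rewrite lerDl.
(* Here ell is 1 as well, so all the c_n vanish. *)
- move=> mu_1 keven.
  have al1 : al = 1 by rewrite -mu0 mu_1 // in_itv /= lexx ler01.
  have be1 : be = 1 by rewrite -mu1 mu_1 // in_itv /= lexx ler01.
  have sgn : (-1) ^+ k = 1 :> R by rewrite -signr_odd (negbTE keven).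
  have c0 n : (0 < n)%N -> c n = 0.
    move=> n0; have := sine_coef_sum hs bc fE n0.
    have -> : sine_coef mu n = affine_coef al be n.
      rewrite -sine_coef_chord; apply: eq_int01 => x x01.
      by rewrite mu_1 ?in_itv // /chord al1 be1 subrr !mul0r add0r.
    by move/eqP; rewrite -{1}[affine_coef al be n]addr0 eq_sym (inj_eq (addrI _)) => /eqP.
  have oc n : over_index c n = 0.
    by case: n => [|n]; rewrite ?over_index0 // /over_index c0 ?mul0r.
  have int0 : inner (fun x => mu x ^+ 2) (derive1 (phi k)) = 0.
    rewrite derive1_phi /inner.
    rewrite (@eq_int01 R _ (fun x => Num.sqrt 2 * (k%:R * pi) * cos (k%:R * pi * x))).
      have w0 : k%:R * pi != 0 :> R.
        by rewrite mulf_neq0 ?gt_eqF ?pi_gt0 ?ltr0n.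
      by rewrite int01Z ?int01_cos ?sin_natpi ?mul0r ?mulr0 //; exact: continuous_cos_lin.
    by move=> x x01; rewrite mu_1 ?in_itv // expr1n mul1r.
  apply/eqaddOP; apply/bigO_exP; exists (M + 1); first lra.
  apply: near1 => w w1.
  have w0 : 0 < w by lra.
  have cS : series (fun i => corr_rest k al be c i.+1 *
       cubic_kernel w (lambda2 R i.+1 k)) @ \oo --> (0 : R).
    rewrite (_ : series _ = cst 0); first exact: cvg_cst.
    apply/funext => N; rewrite /series /= big1 // => i _.
    by rewrite /corr_rest /corr !oc !(addr0, mulr0, mul0r).
  have := HM w 0 w1 cS.
  rewrite int0 al1 be1 sgn mulr0 !mul0r sub0r addr0 expr1n mul1r.
  rewrite !fctE /=.
  have W0 : 0 < (w `^ (7 / 2))^-1 by rewrite invr_gt0 powR_gt0.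
  rewrite (gtr0_norm W0).
  have -> : pi ^+ 2 * Num.sqrt 2 * (1 + 1 * 1) / w `^ (5 / 2) =
     2 * pi ^+ 2 * Num.sqrt 2 / w `^ (5 / 2) by congr (_ / _); ring.
  move/le_trans; apply.
  by apply: ler_wpM2r; [exact: ltW|rewrite lerDl].
Unshelve. all: by end_near. Qed.
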